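(* Let $(a,b)\in\overline{\mathbf H}$. There is a unique $y\in\mathbb C$ for which there exists $(c,d)\in\overline{\mathbf H}$ with $$(c(z),d(z)z)=(1+|y|^2)^{-1/2}(1,-y)(a(z),b(z))\quad\text{for a.e. }z\in\mathbb T.$$ Consequently one may define recursively $(a_0,b_0)=(a,b)$ and, for $n\ge0$, $(a_{n+1}(z),b_{n+1}(z)z)=(1+|F_n|^2)^{-1/2}(1,-F_n)(a_n(z),b_n(z))$, where $F_n$ is the unique complex number such that $(a_{n+1},b_{n+1})\in\overline{\mathbf H}$. Then the sequence $(F_n)_{n\ge0}$ is square summable and $$a(\infty)\le\prod_{n\ge0}(1+|F_n|^2)^{-1/2}.$$ If $(a,b)\notin\mathbf H$, the inequality is strict.
   Context: $\mathbb T$ is the unit circle, $\mathbb D$ the open unit disc, $\mathbb D^*=\{\overline z^{-1}:z\in\mathbb D\}$, $a^*(z)=\overline{a(\overline z^{-1})}$ (so $a^*=\overline a$ on $\mathbb T$). $H^2(\mathbb D)$ is the space of $f\in L^2(\mathbb T)$ with vanishing negative Fourier coefficients (identified with its analytic extension to $\mathbb D$); $H^2(\mathbb D^* )$ the space of $f$ with $f^*\in H^2(\mathbb D)$, and $f(\infty):=\overline{f^*(0)}$. Pairs multiply as $(a,b)(c,d)=(ac-bd^*,ad+bc^* )$, with $y^*=\overline y$ for a constant $y$; thus $(1,-y)(a,b)=(a+yb^*,b-ya^* )$. $\mathbf L$ is the set of pairs $(a,b)$ of measurable functions on $\mathbb T$ with $aa^*+bb^*=1$ a.e., $a\in H^2(\mathbb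 D^* )$, $a(\infty)>0$. $\overline{\mathbf H}$ is the set of $(a,b)\in\mathbf L$ with $b\in H^2(\mathbb D)$. $\mathbf H$ is the set of $(a,b)\in\overline{\mathbf H}$ such that $a^*$ and $b$ have no common inner factor: whenever $g$ is an inner function (an $H^\infty(\mathbb D)$ function with $|g|=1$ a.e. on $\mathbb T$) with $a^*g^{-1},bg^{-1}\in H^2(\mathbb D)$, $g$ is constant. *)

(* Defs.v *)
From HB Require Import structures.
From mathcomp Require Import all_boot all_order all_algebra.
From mathcomp Require Import all_classical all_reals all_analysis.
From mathcomp Require Import complex.
Set Implicit Arguments. Unset Strict Implicit. Unset Printing Implicit Defensive.
Import Order.TTheory GRing.Theory Num.Theory.
Import numFieldNormedType.Exports.
Local Open Scope classical_set_scope.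
Local Open Scope ring_scope.

Section Hardy.
Variable R : realType.

(* The unit circle T is parametrized by t in [0, 2 pi], z = e^{it};
   the measure is Lebesgue measure on this interval. *)
Definition circ : set R := `[0, pi *+ 2]%classic.
Definition expi (t : R) : R[i] := Complex (cos t) (sin t).
Definition mu := @lebesgue_measure R.

Definition ae_T (P : R -> Prop) : Prop := {ae mu, forall t, circ t -> P t}.

Definition cconj (x : R[i]) : R[i] := Complex (complex.Re x) (- complex.Im x).
Definition normsq (x : R[i]) : R := complex.Re x ^+ 2 + complex.Im x ^+ 2.

Definition cmeasurable (f : R -> R[i]) : Prop :=
  measurable_fun circ (fun t => complex.Re (f t)) /\ measurable_fun circ (fun t => complex.Im (f t)).

Definition L2 (f : R -> R[i]) : Prop :=
  cmeasurable f /\ (\int[mu]_(t in circ) (normsq (f t))%:E < +oo)%E.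

Definition cint (f : R -> R[i]) : R[i] :=
  Complex (Rintegral mu circ (fun t => complex.Re (f t))) (Rintegral mu circ (fun t => complex.Im (f t))).

Definition fourier (f : R -> R[i]) (n : int) : R[i] :=
  Complex (pi *+ 2)^-1 0 * cint (fun t => f t * expi (- (n%:~R) * t)).

Definition H2 (f : R -> R[i]) : Prop :=
  L2 f /\ forall n : int, (n < 0)%R -> fourier f n = 0.

(* f^* restricted to T is the conjugate of f *)
Definition fstar (f : R -> R[i]) : R -> R[i] := fun t => cconj (f t).

Definition H2star (f : R -> R[i]) : Prop := H2 (fstar f).

(* f(oo) := conj (f^*(0)); f^*(0) is the 0-th Fourier coefficient of f^* *)
Definition at_infty (f : R -> R[i]) : R[i] := cconj (fourier (fstar f) 0).

Definition Lset (a b : R -> R[i]) : Prop :=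
  cmeasurable a /\ cmeasurable b /\
  ae_T (fun t => a t * cconj (a t) + b t * cconj (b t) = 1) /\
  H2star a /\ 0 < at_infty a.

Definition Hbar (a b : R -> R[i]) : Prop := Lset a b /\ H2 b.

Definition Hinf (g : R -> R[i]) : Prop :=
  H2 g /\ exists M : R, ae_T (fun t => normsq (g t) <= M).

Definition inner (g : R -> R[i]) : Prop :=
  Hinf g /\ ae_T (fun t => g t * cconj (g t) = 1).

Definition const_ae (g : R -> R[i]) : Prop :=
  exists c : R[i], ae_T (fun t => g t = c).

Definition Hset (a b : R -> R[i]) : Prop :=
  Hbar a b /\
  forall g, inner g -> H2 (fun t => cconj (a t) / g t) -> H2 (fun t => b t / g t) ->
    const_ae g.

Definition scal (y : R[i]) : R := (Num.sqrt (1 + normsq y))^-1.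

(* (c(z), d(z) z) = (1+|y|^2)^{-1/2} (1,-y)(a(z),b(z)) for a.e. z in T,
   where (1,-y)(a,b) = (a + y conj b, b - y conj a) *)
Definition step_rel (y : R[i]) (a b c d : R -> R[i]) : Prop :=
  ae_T (fun t => c t = ((scal y)%:C)%C * (a t + y * cconj (b t)) /\
                 d t * expi t = ((scal y)%:C)%C * (b t - y * cconj (a t))).

Definition schur_seq (a b : R -> R[i]) (A B : nat -> R -> R[i]) (F : nat -> R[i]) : Prop :=
  A 0%N = a /\ B 0%N = b /\ (forall n, Hbar (A n) (B n)) /\
  (forall n, step_rel (F n) (A n) (B n) (A n.+1) (B n.+1)).

Definition partial_prod (F : nat -> R[i]) (n : nat) : R := \prod_(k < n) scal (F k).

End Hardy.

(* Main.v *)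
(* Let A = a(oo) > 0 be the mean of a.  Dividing (b - y a^* ) by z stays in H^2
   exactly when its mean vanishes, that is, when y is the mean of b divided by
   A; and then A = (1 + |y|^2)^(-1/2) c(oo).  Iterating, A is the n-th partial
   product times a_n(oo), and a_n(oo) <= 1 since |a_n| <= 1; this bounds the
   partial products from below and gives both the summability and the
   inequality.  If a nonconstant inner function g divides a^* and b, then, evaluation
   at 0 being multiplicative on bounded Hardy functions, g divides every a_n^*
   and b_n, so a_n(oo) <= |g(0)| < 1 uniformly in n and the inequality is strict.

   Multiplicativity of the mean, for functions only known through their Fourier
   coefficients, rests on the L^2 density of trigonometric polynomials: the
   Fejer means of the sawtooth series converge boundedly, so differences of
   translates approximate indicators of intervals, hence by Dynkin's lemma those
   of all measurable sets. *)
Require Import Defs.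
From HB Require Import structures.
From mathcomp Require Import all_boot all_order all_algebra.
From mathcomp Require Import all_classical all_reals all_analysis.
From mathcomp Require Import complex.
From mathcomp Require Import measurable_realfun.
From mathcomp Require Import ring lra zify.
Import Order.TTheory GRing.Theory Num.Theory.
Import numFieldNormedType.Exports.
Local Open Scope classical_set_scope.
Local Open Scope ring_scope.

(** * The Fejer kernel and the sawtooth *)

Section FejerKernel.
Context {R : realType}.
Implicit Types (t x : R) (n N : nat).

(** The Dirichlet kernel, the sum of e^{ikt} over |k| <= n, in real form. *)
Definition dirichlet n t : R := 1 + \sum_(k < n) 2 * cos (k.+1%:R * t).
(** Not divided by [N]: this is [N] times the usual Fejer kernel, just as [sawSum N] is [N] times a
    Cesaro mean. *)
Definition fejer N t : R := \sum_(n < N) dirichlet n t.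
(** Partial sums of the Fourier series of the sawtooth pi - t on ]0, 2 pi[. *)
Definition sineSum n t : R := \sum_(k < n) 2 / k.+1%:R * sin (k.+1%:R * t).
Definition sawSum N t : R := \sum_(n < N) sineSum n t.

(** By induction: 2 cos((n+1)t) (1 - cos t) = 2 cos((n+1)t) - cos((n+2)t) - cos(nt). The right-hand
    side telescopes when summed over [n], which yields [fejerE]. *)
Lemma dirichletE n t :
  dirichlet n t * (1 - cos t) = cos (n%:R * t) - cos (n.+1%:R * t).
Proof.
elim: n => [|n IH].
  by rewrite /dirichlet big_ord0 addr0 !mul1r mul0r cos0.
rewrite /dirichlet big_ord_recr /= addrA mulrDl IH.
have e2 : n.+2%:R * t = n.+1%:R * t + t by rewrite -[n.+2]addn1 natrD mulrDl mul1r.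
have e0 : n%:R * t = n.+1%:R * t - t by rewrite -[n.+1]addn1 natrD mulrDl mul1r addrK.
rewrite e2 e0 cosB cosD; ring.
Qed.

Lemma fejerE N t : fejer N t * (1 - cos t) = 1 - cos (N%:R * t).
Proof.
rewrite /fejer mulr_suml; elim: N => [|N IH].
  by rewrite big_ord0 mul0r cos0 subrr.
by rewrite big_ord_recr /= IH dirichletE; ring.
Qed.

(** The added [x] produces the constant term 1 of the kernel. *)
Lemma is_derive_sineSum n t :
  is_derive t 1 (fun x => x + sineSum n x) (dirichlet n t).
Proof.
elim: n => [|n IH].
  rewrite /dirichlet big_ord0 addr0.
  rewrite [X in is_derive _ _ X _](_ : _ = id); first exact: is_derive_id.
  by apply/funext => x; rewrite /sineSum big_ord0 addr0.
rewrite [X in is_derive _ _ X _](_ : _ = (fun x => x + sineSum n x) \+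
   (fun x => 2 / n.+1%:R * sin (n.+1%:R * x))); last first.
  by apply/funext => x; rewrite /sineSum big_ord_recr /= addrA.
rewrite /dirichlet big_ord_recr /= addrA.
apply: is_deriveD.
have h : is_derive t 1 (fun x => sin (n.+1%:R * x)) (n.+1%:R * cos (n.+1%:R * t)).
  have hd : is_derive t 1 (fun x : R => n.+1%:R * x) (n.+1%:R * 1).
    exact: (is_deriveZ (n.+1%:R : R) (is_derive_id t (1 : R))).
  apply: is_derive_eq (is_derive1_comp (is_derive_sin _) hd) _.
  by rewrite mulr1 mulrC.
have -> : 2 * cos (n.+1%:R * t) = (2 / n.+1%:R) *: (n.+1%:R * cos (n.+1%:R * t)) :> R.
  by rewrite /GRing.scale /= mulrA divfK // pnatr_eq0.
exact: is_deriveZ.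
Qed.

Lemma is_derive_sawSum N t :
  is_derive t 1 (fun x => N%:R * x + sawSum N x) (fejer N t).
Proof.
elim: N => [|N IH].
  rewrite /fejer big_ord0.
  rewrite [X in is_derive _ _ X _](_ : _ = cst 0); first exact: is_derive_cst.
  by apply/funext => x; rewrite /sawSum big_ord0 addr0 mul0r.
rewrite [X in is_derive _ _ X _](_ : _ = (fun x => N%:R * x + sawSum N x) \+
   (fun x => x + sineSum N x)); last first.
  apply/funext => x; rewrite /sawSum big_ord_recr /= -[N.+1]addn1 natrD; ring.
rewrite /fejer big_ord_recr /=.
apply: is_deriveD; exact: is_derive_sineSum.
Qed.

Lemma sin_natmul_pi n : sin (n%:R * pi) = 0 :> R.
Proof.
elim: n => [|n IH]; first by rewrite mul0r sin0.
by rewrite -[n.+1]addn1 natrD mulrDl mul1r sinDpi IH oppr0.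
Qed.

Lemma sawSum_pi N : sawSum N pi = 0.
Proof.
rewrite /sawSum big1 // => n _; rewrite /sineSum big1 // => k _.
by rewrite sin_natmul_pi mulr0.
Qed.

Lemma sawSumN N t : sawSum N (- t) = - sawSum N t.
Proof.
rewrite /sawSum -sumrN; apply: eq_bigr => n _.
rewrite /sineSum -sumrN; apply: eq_bigr => k _.
by rewrite mulrN sinN mulrN.
Qed.

Lemma sawSum0 N : sawSum N 0 = 0.
Proof.
have /eqP := sawSumN N 0.
by rewrite oppr0 -addr_eq0 -mulr2n mulrn_eq0 => /eqP.
Qed.

Lemma sawSumD2pi N t : sawSum N (t + pi *+ 2) = sawSum N t.
Proof.
rewrite /sawSum; apply: eq_bigr => n _; rewrite /sineSum; apply: eq_bigr => k _.
congr (_ * _); rewrite mulrDr (mulr_natl (pi *+ 2)).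
exact: (periodicn (@sinD2pi R)).
Qed.

(** In [fejerE] the right-hand side lies between 0 and 2, and the factor 1 - cos t is positive. *)
Lemma fejer_le N t : 0 < t < pi ->
  0 <= fejer N t <= 2 / (1 - cos t).
Proof.
move=> tpi.
have c1 : 0 < 1 - cos t.
  rewrite subr_gt0 -[X in _ < X]cos0 ltr_cos ?in_itv /=; first by case/andP: tpi.
    by rewrite lexx pi_ge0.
  by case/andP: tpi => /ltW-> /ltW->.
rewrite ler_pdivlMr // fejerE; apply/andP; split.
  rewrite -(pmulr_lge0 _ c1) fejerE subr_ge0; exact: cos_le1.
by have := cos_geN1 (N%:R * t); lra.
Qed.

(** The mean value theorem stands in for integrating the kernel: the sign and the size of [fejer]
    pass to increments of N t + [sawSum N t]. *)
Lemma sawSum_mvt N t x : 0 <= t -> t < x -> x <= pi ->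
  exists2 c, t < c < x &
    (N%:R * x + sawSum N x) - (N%:R * t + sawSum N t) = fejer N c * (x - t).
Proof.
move=> t0 tx xpi.
pose f y : R := N%:R * y + sawSum N y.
have df (y : R) : is_derive y (1 : R) f (fejer N y) by exact: is_derive_sawSum.
have cf : {within `[t, x], continuous f}.
  apply: derivable_within_continuous => y _.
  by have [] := df y.
have [c] := MVT tx (fun y _ => df y) cf.
by rewrite in_itv /= => cI e; exists c.
Qed.

(** Since the kernel is nonnegative, N t + [sawSum N t] stays between its values 0 and N pi at the
    endpoints. So does N t, and the difference of the two is at most N pi in absolute value. *)
Lemma sawSum_bound0 N t : 0 <= t <= pi -> `|sawSum N t| <= N%:R * pi.
Proof.
move=> /andP[t0 tpi].
have NP : 0 <= N%:R * pi :> R by rewrite mulr_ge0 // ?ler0n // pi_ge0.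
have [->|tn0] := eqVneq t 0; first by rewrite sawSum0 normr0.
have [->|tnp] := eqVneq t pi; first by rewrite sawSum_pi normr0.
have {}t0 : 0 < t by rewrite lt_neqAle eq_sym tn0.
have {}tpi : t < pi by rewrite lt_neqAle tnp.
have [c cI e] := sawSum_mvt N 0 t (lexx _) t0 (ltW tpi).
have [d dI e'] := sawSum_mvt N t pi (ltW t0) tpi (lexx _).
have /andP[c0 _] : 0 <= fejer N c <= 2 / (1 - cos c) by apply: fejer_le; lra.
have /andP[d0 _] : 0 <= fejer N d <= 2 / (1 - cos d) by apply: fejer_le; lra.
have {e}h1 : 0 <= N%:R * t + sawSum N t.
  move: e; rewrite sawSum0 mulr0 addr0 subr0 subr0 => ->; apply: mulr_ge0 => //; exact: ltW.
have {e'}h2 : N%:R * t + sawSum N t <= N%:R * pi.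
  rewrite -subr_ge0; move: e'; rewrite sawSum_pi addr0 => ->; apply: mulr_ge0 => //.
  by rewrite subr_ge0 ltW.
have h3 : N%:R * t <= N%:R * pi by rewrite ler_wpM2l // ltW.
have h4 : 0 <= N%:R * t by rewrite mulr_ge0 // ltW.
rewrite ler_norml; lra.
Qed.

(** Oddness and periodicity reduce to [0, pi]. *)
Lemma sawSum_bound N t : - (pi *+ 2) <= t <= pi *+ 2 -> `|sawSum N t| <= N%:R * pi.
Proof.
rewrite mulr2n => /andP[h1 h2].
have [t0|t0] := leP 0 t; last first.
  rewrite -normrN -sawSumN.
  have [tp|tp] := leP (- t) pi; first by apply: sawSum_bound0; rewrite tp oppr_ge0 ltW.
  rewrite -normrN -sawSumN -sawSumD2pi mulr2n; apply: sawSum_bound0; lra.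
have [tp|tp] := leP t pi; first by apply: sawSum_bound0; rewrite tp t0.
rewrite -normrN -sawSumN -sawSumD2pi mulr2n; apply: sawSum_bound0; lra.
Qed.

(** On [t, pi] the kernel is bounded by 2 / (1 - cos t), whatever [N] is. Hence N (pi - t) -
    [sawSum N t] stays bounded, and dividing by [N] sends it to 0. *)
Lemma sawSum_cvg0 t : 0 < t < pi ->
  (sawSum N t / N%:R) @[N --> \oo] --> pi - t.
Proof.
move=> /andP[t0 tpi].
pose C : R := 2 / (1 - cos t) * pi.
have c1 : 0 < 1 - cos t.
  rewrite subr_gt0 -[X in _ < X]cos0 ltr_cos ?in_itv /= //.
    by rewrite lexx pi_ge0.
  by rewrite (ltW t0) ltW.
apply/cvgrPdist_le => e e0.
near=> N.
have N0 : 0 < N%:R :> R.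
  by rewrite ltr0n; near: N; exists 1%N.
have [d /andP[td dp] e'] := sawSum_mvt N t pi (ltW t0) tpi (lexx _).
have /andP[d0 d1] : 0 <= fejer N d <= 2 / (1 - cos d) by apply: fejer_le; lra.
have -> : pi - t - sawSum N t / N%:R = fejer N d * (pi - t) / N%:R.
  by rewrite -e' sawSum_pi; field; rewrite lt0r_neq0.
have h2 : fejer N d <= 2 / (1 - cos t).
  apply: (le_trans d1); rewrite ler_pM2l // lef_pV2 ?posrE //.
    by rewrite lerD2l lerN2 ltW // ltr_cos ?in_itv /=; lra.
  by apply: (lt_le_trans c1); rewrite lerD2l lerN2 ltW // ltr_cos ?in_itv /=; lra.
rewrite ger0_norm; last by rewrite !mulr_ge0 // ?subr_ge0 ?invr_ge0 // ltW.
rewrite ler_pdivrMr //.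
have h3 : fejer N d * (pi - t) <= C.
  by apply: ler_pM => //; lra.
apply: (le_trans h3).
rewrite -ler_pdivrMl //.
near: N; exact: nbhs_infty_ger.
Unshelve. all: by end_near.
Qed.

(* The Cesaro means of [\sum_k 2 sin (k t) / k] converge boundedly to the
   sawtooth [pi - t]. *)
Lemma sawSum_cvg t : 0 < t < pi *+ 2 ->
  (sawSum N t / N%:R) @[N --> \oo] --> pi - t.
Proof.
rewrite mulr2n => /andP[t0 t2].
have [tp|tp|->] := ltgtP t pi.
- by apply: sawSum_cvg0; rewrite t0.
- have E N : sawSum N t = - sawSum N (pi *+ 2 - t).
    by rewrite -sawSumN opprB -[RHS]sawSumD2pi subrK.
  under eq_cvg do rewrite E mulNr.
  have -> : pi - t = - (pi - (pi *+ 2 - t)) by rewrite mulr2n; ring.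
  apply: cvgN; apply: sawSum_cvg0; rewrite mulr2n; lra.
- under eq_cvg do rewrite sawSum_pi mul0r.
  rewrite subrr; exact: cvg_cst.
Qed.

End FejerKernel.

(** * Bounded functions on the circle *)

Section ComplexFacts.
Context {R : realType}.
Implicit Types x y : R[i].

Lemma ReD x y : complex.Re (x + y) = complex.Re x + complex.Re y.
Proof. by case: x y => [? ?] []. Qed.
Lemma ImD x y : complex.Im (x + y) = complex.Im x + complex.Im y.
Proof. by case: x y => [? ?] []. Qed.
Lemma ReM x y :
  complex.Re (x * y) = complex.Re x * complex.Re y - complex.Im x * complex.Im y.
Proof. by case: x y => [? ?] []. Qed.
Lemma ImM x y :
  complex.Im (x * y) = complex.Re x * complex.Im y + complex.Im x * complex.Re y.
Proof. by case: x y => [? ?] []. Qed.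

Lemma complex_ext x y : complex.Re x = complex.Re y -> complex.Im x = complex.Im y -> x = y.
Proof. by case: x y => [? ?] [? ?] /= -> ->. Qed.

Lemma cconjD x y : cconj (x + y) = cconj x + cconj y.
Proof. by apply: complex_ext; rewrite /= ?ReD ?ImD //= ?ImD opprD. Qed.
Lemma cconjM x y : cconj (x * y) = cconj x * cconj y.
Proof. by apply: complex_ext; rewrite ?ReM ?ImM /= ?ReM ?ImM /=; ring. Qed.
Lemma cconjK x : cconj (cconj x) = x.
Proof. by apply: complex_ext => //=; rewrite opprK. Qed.
Lemma cconjN x : cconj (- x) = - cconj x.
Proof. by case: x. Qed.
Lemma cconjR (r : R) : cconj (r%:C)%C = (r%:C)%C.
Proof. by apply: complex_ext => //=; rewrite oppr0. Qed.

Lemma mul_cconj x : x * cconj x = ((normsq x)%:C)%C.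
Proof. by apply: complex_ext; rewrite ?ReM ?ImM /= /normsq; ring. Qed.

Lemma normsq_ge0 x : 0 <= normsq x.
Proof. by rewrite addr_ge0 // sqr_ge0. Qed.
Lemma normsqM x y : normsq (x * y) = normsq x * normsq y.
Proof. by rewrite /normsq ReM ImM; ring. Qed.
Lemma normsq_cconj x : normsq (cconj x) = normsq x.
Proof. by rewrite /normsq /= sqrrN. Qed.
Lemma normsqR (r : R) : normsq (r%:C)%C = r ^+ 2.
Proof. by rewrite /normsq /= expr0n addr0. Qed.
Lemma normsqN x : normsq (- x) = normsq x.
Proof. by case: x => u v; rewrite /normsq /= !sqrrN. Qed.
Lemma normsq0 : normsq (0 : R[i]) = 0.
Proof. by rewrite /normsq /= expr0n addr0. Qed.
Lemma normsq_eq0 x : (normsq x == 0) = (x == 0).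
Proof.
apply/idP/eqP => [|->]; last by rewrite normsq0.
rewrite /normsq paddr_eq0 ?sqr_ge0 // !sqrf_eq0 => /andP[/eqP ? /eqP ?].
exact: complex_ext.
Qed.
Lemma normsqD x y : normsq (x + y) <= 2 * normsq x + 2 * normsq y.
Proof.
rewrite /normsq ReD ImD.
have := sqr_ge0 (complex.Re x - complex.Re y).
have := sqr_ge0 (complex.Im x - complex.Im y).
rewrite !expr2; lra.
Qed.

Lemma expiD (s t : R) : expi (s + t) = expi s * expi t.
Proof. by apply: complex_ext; rewrite ?ReM ?ImM /= ?cosD ?sinD; ring. Qed.
Lemma expi0 : expi (0 : R) = 1.
Proof. by apply: complex_ext; rewrite /= ?cos0 ?sin0. Qed.
Lemma expiN (t : R) : expi (- t) = cconj (expi t).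
Proof. by apply: complex_ext; rewrite /= ?cosN ?sinN. Qed.
Lemma normsq_expi (t : R) : normsq (expi t) = 1.
Proof. exact: cos2Dsin2. Qed.
Lemma mul_expiN (t : R) : expi t * expi (- t) = 1.
Proof. by rewrite -expiD subrr expi0. Qed.

End ComplexFacts.

(** * Reasoning almost everywhere on the circle *)

Section AlmostEverywhere.
Context {R : realType}.
Implicit Types P Q : R -> Prop.

Let aeF : Filter (almost_everywhere (@lebesgue_measure R)).
Proof. exact: ae_filter_ringOfSetsType. Qed.

Lemma ae_T_all P : (forall t, P t) -> ae_T P.
Proof.
by move=> h; apply: (@filterS _ _ aeF setT) => [t _ _|]; [exact: h|exact: (@filterT _ _ aeF)].
Qed.

Lemma ae_T_imp P Q : (forall t, circ t -> P t -> Q t) -> ae_T P -> ae_T Q.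
Proof. by move=> PQ h; apply: (@filterS _ _ aeF _ _ _ h) => t Pt ct; apply: (PQ _ ct (Pt ct)). Qed.

Lemma ae_T_imp2 P Q S : (forall t, circ t -> P t -> Q t -> S t) -> ae_T P -> ae_T Q -> ae_T S.
Proof.
move=> PQS h1 h2; apply: (@filterS2 _ _ aeF _ _ _ _ h1 h2) => t Pt Qt ct.
exact: (PQS _ ct (Pt ct) (Qt ct)).
Qed.

End AlmostEverywhere.

Section BoundedFunctions.
Context {R : realType}.
Implicit Types (f g : R -> R[i]) (u v : R -> R) (c : R[i]).
Local Notation mu := (@lebesgue_measure R).
Local Notation circ := (@circ R).

Lemma circ_measurable : measurable circ.
Proof. exact: measurable_itv. Qed.
Hint Resolve circ_measurable : core.

Lemma pi2_gt0 : 0 < (pi : R) *+ 2.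
Proof. by rewrite pmulrn_lgt0 // pi_gt0. Qed.

Lemma mu_circ : mu circ = (pi *+ 2)%:E.
Proof.
by rewrite /Defs.circ lebesgue_measure_itv /= lte_fin pi2_gt0 -EFinD subr0.
Qed.

Lemma ae_bounded_integrable u (M : R) : measurable_fun circ u ->
  ae_T (fun t => `|u t| <= M) -> mu.-integrable circ (EFin \o u).
Proof.
move=> mu_ ub; apply/integrableP; split; first exact/measurable_EFinP.
(* The maximum with 0 makes the dominating constant nonnegative, as the comparison of integrals
   asks. *)
apply: (@le_lt_trans _ _ (\int[mu]_(t in circ) (cst (Num.max M 0)%:E t))%E); last first.
  by rewrite integral_cst // [X in (_ * X)%E]mu_circ ltry.
apply: ae_ge0_le_integral => //.
- by apply: measurableT_comp => //; apply/measurable_EFinP.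
- by move=> t _; rewrite lee_fin le_max lexx orbT.
- apply: ae_T_imp ub => t _ h; by rewrite /= lee_fin le_max h.
Qed.

Definition rint u : R := Rintegral mu circ u.

Lemma rint_ae u v : measurable_fun circ u -> measurable_fun circ v ->
  ae_T (fun t => u t = v t) -> rint u = rint v.
Proof.
move=> m1 m2 h; rewrite /rint /Rintegral; congr fine.
apply: ae_eq_integral => //; try exact/measurable_EFinP.
by apply: ae_T_imp h => t _ /= ->.
Qed.

(** Bounded convergence: the circle has finite measure, so a constant is a dominating function. *)
Lemma rint_cvg0 (h : nat -> R -> R) (M : R) :
  (forall n, measurable_fun circ (h n)) ->
  (forall n, ae_T (fun t => `|h n t| <= M)) ->
  ae_T (fun t => h n t @[n --> \oo] --> (0 : R)) ->
  rint (h n) @[n --> \oo] --> (0 : R).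
Proof.
move=> mh hM h0.
pose f n t : \bar R := (h n t)%:E.
have mf n : measurable_fun circ (f n) by exact/measurable_EFinP.
have m0 : measurable_fun circ (fun=> 0%E : \bar R) by exact: measurable_cst.
have f0 : {ae mu, forall t, circ t -> f ^~ t @ \oo --> (0%E : \bar R)}.
  by apply: ae_T_imp h0 => t _ ht; apply: cvg_EFin ht; exact: nearW.
have iM : mu.-integrable circ (fun=> M%:E).
  have mM : measurable_fun circ (cst M : R -> R) by exact: measurable_cst.
  exact: (ae_bounded_integrable _ `|M| mM (ae_T_all (fun=> `|M| <= `|M|) (fun=> lexx _))).
have fM : {ae mu, forall t n, circ t -> (`|f n t| <= M%:E)%E}.
  have /ae_foralln hM' : forall n, {ae mu, forall t, circ t -> `|h n t| <= M} by exact: hM.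
  apply: (@filterS _ _ (ae_filter_ringOfSetsType _) _ _ _ hM') => t ht n ct.
  by rewrite /= lee_fin ht.
have [_ _] := @dominated_convergence _ _ R mu circ circ_measurable
  f (fun=> 0%E) (fun=> M%:E) mf m0 f0 iM fM.
rewrite integral0_eq // => H.
exact: (fine_cvg H).
Qed.

Definition Linf f := cmeasurable f /\ exists M : R, ae_T (fun t => normsq (f t) <= M).

End BoundedFunctions.

(** * Normalized means and the squared L^2 norm *)

Section Mean.
Context {R : realType}.
Implicit Types (f g : R -> R[i]) (u v : R -> R) (c : R[i]) (r : R).
Local Notation mu := (@lebesgue_measure R).
Local Notation circ := (@circ R).
Let circ_m : measurable circ := circ_measurable.
Hint Resolve circ_m : core.

Definition essbd u := measurable_fun circ u /\ exists M : R, ae_T (fun t => `|u t| <= M).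

Lemma essbd_integrable u : essbd u -> mu.-integrable circ (EFin \o u).
Proof. by case=> mu [M hM]; exact: ae_bounded_integrable hM. Qed.

Lemma essbd_cst r : essbd (fun=> r).
Proof. by split; [exact: measurable_cst|exists `|r|; apply: ae_T_all]. Qed.

Lemma essbdD u v : essbd u -> essbd v -> essbd (fun t => u t + v t).
Proof.
move=> [mu [M hM]] [mv [N hN]]; split; first exact: measurable_funD.
exists (M + N); apply: ae_T_imp2 hM hN => t _ h1 h2.
by apply: (le_trans (ler_normD _ _)); exact: lerD.
Qed.

Lemma essbdM u v : essbd u -> essbd v -> essbd (fun t => u t * v t).
Proof.
move=> [mu [M hM]] [mv [N hN]]; split; first exact: measurable_funM.
exists (M * N); apply: ae_T_imp2 hM hN => t _ h1 h2.
by rewrite normrM; exact: ler_pM.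
Qed.

Definition avg u : R := (pi *+ 2)^-1 * rint u.

Lemma avgD u v : essbd u -> essbd v -> avg (fun t => u t + v t) = avg u + avg v.
Proof.
move=> hu hv; rewrite /avg -mulrDr; congr (_ * _).
by apply: RintegralD => //; exact: essbd_integrable.
Qed.

Lemma avgZ r u : essbd u -> avg (fun t => r * u t) = r * avg u.
Proof.
move=> hu; rewrite /avg mulrCA; congr (_ * _).
by apply: RintegralZl => //; exact: essbd_integrable.
Qed.

Lemma avg_cst r : avg (fun=> r) = r.
Proof.
rewrite /avg /rint Rintegral_cst // [fine _](_ : _ = pi *+ 2); last first.
  by rewrite [X in fine X]mu_circ.
by rewrite mulrCA mulVf ?mulr1 // lt0r_neq0 // pi2_gt0.
Qed.

Lemma avg_ae u v : measurable_fun circ u -> measurable_fun circ v ->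
  ae_T (fun t => u t = v t) -> avg u = avg v.
Proof. by move=> mu mv h; rewrite /avg (rint_ae u v mu mv h). Qed.

Lemma avg_ge0 u : (forall t, 0 <= u t) -> 0 <= avg u.
Proof.
move=> h; rewrite /avg mulr_ge0 // ?invr_ge0 ?(ltW pi2_gt0) //.
by apply: Rintegral_ge0 => t _; exact: h.
Qed.

Lemma avg_le u v : essbd u -> essbd v -> (forall t, u t <= v t) -> avg u <= avg v.
Proof.
move=> hu hv uv; rewrite /avg ler_wpM2l // ?invr_ge0 ?(ltW pi2_gt0) //.
by apply: le_Rintegral => //; exact: essbd_integrable.
Qed.

Lemma avg_eq0 u : essbd u -> (forall t, 0 <= u t) -> avg u = 0 -> ae_T (fun t => u t = 0).
Proof.
move=> hu u0 /eqP; rewrite /avg mulf_eq0 invr_eq0 (gt_eqF pi2_gt0) /= => /eqP r0.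
have iu := essbd_integrable _ hu.
have fu : (\int[mu]_(t in circ) `|(u t)%:E| = 0)%E.
  have -> : (\int[mu]_(t in circ) `|(u t)%:E| = \int[mu]_(t in circ) (u t)%:E)%E.
    by apply: eq_integral => t _; rewrite /= ger0_norm.
  rewrite -[LHS]fineK; first by rewrite -[0%E]/((0:R)%:E) -r0.
  by apply: integrable_fin_num => //; exact: iu.
have mE : measurable_fun circ (EFin \o u) by apply/measurable_EFinP; case: hu.
have := (ae_eq_integral_abs mu circ_m mE).1 fu.
by apply: ae_T_imp => t _ [].
Qed.

Lemma LinfP f :
  Linf f <-> essbd (fun t => complex.Re (f t)) /\ essbd (fun t => complex.Im (f t)).
Proof.
(* This turns a bound on squares into a bound on absolute values without square roots. *)
have sq (x : R) : `|x| <= 1 + x ^+ 2.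
  by rewrite ler_norml; apply/andP; split;
    have := sqr_ge0 (x - 1); have := sqr_ge0 (x + 1); rewrite !expr2; lra.
split.
  move=> [[m1 m2] [M hM]]; split; split=> //; exists (1 + M); apply: ae_T_imp hM => t _ h;
  apply: (le_trans (sq _)); rewrite lerD2l; apply: le_trans h; rewrite /normsq.
    by rewrite lerDl sqr_ge0.
  by rewrite lerDr sqr_ge0.
move=> [[m1 [M hM]] [m2 [N hN]]]; split; first by split.
exists (M ^+ 2 + N ^+ 2); apply: ae_T_imp2 hM hN => t _ h1 h2.
rewrite /normsq.
rewrite -(real_normK (num_real (complex.Re (f t)))) -(real_normK (num_real (complex.Im (f t)))).
by rewrite lerD // !expr2 ler_pM.
Qed.

Lemma Linf_cst c : Linf (fun=> c).
Proof. by apply/LinfP; split; exact: essbd_cst. Qed.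

Lemma LinfD f g : Linf f -> Linf g -> Linf (fun t => f t + g t).
Proof.
move=> /LinfP[f1 f2] /LinfP[g1 g2]; apply/LinfP; split.
  by under eq_fun do rewrite ReD; exact: essbdD.
by under eq_fun do rewrite ImD; exact: essbdD.
Qed.

Lemma LinfM f g : Linf f -> Linf g -> Linf (fun t => f t * g t).
Proof.
move=> /LinfP[f1 f2] /LinfP[g1 g2]; apply/LinfP; split.
  under eq_fun do rewrite ReM -mulN1r; apply: essbdD; first exact: essbdM.
  by apply: essbdM; [exact: essbd_cst|exact: essbdM].
by under eq_fun do rewrite ImM; apply: essbdD; exact: essbdM.
Qed.

Lemma Linf_conj f : Linf f -> Linf (fun t => cconj (f t)).
Proof.
move=> /LinfP[f1 f2]; apply/LinfP; split => //=.
by under eq_fun do rewrite -mulN1r; apply: essbdM => //; exact: essbd_cst.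
Qed.

Lemma LinfN f : Linf f -> Linf (fun t => - f t).
Proof. by move=> h; under eq_fun do rewrite -mulN1r; apply: LinfM => //; exact: Linf_cst. Qed.

Lemma LinfB f g : Linf f -> Linf g -> Linf (fun t => f t - g t).
Proof. by move=> hf hg; apply: LinfD => //; exact: LinfN. Qed.

Lemma Linf_expi r : Linf (fun t => expi (r * t)).
Proof.
have mr : measurable_fun circ (fun t : R => r * t).
  by apply: measurable_funM => //; exact: measurable_cst.
apply/LinfP; split; split => /=.
- apply: (measurableT_comp _ mr); apply: continuous_measurable_fun; exact: continuous_cos.
- by exists 1; apply: ae_T_all => t; exact: cos_max.
- apply: (measurableT_comp _ mr); apply: continuous_measurable_fun; exact: continuous_sin.
- by exists 1; apply: ae_T_all => t; exact: sin_max.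
Qed.

Lemma essbd_normsq f : Linf f -> essbd (fun t => normsq (f t)).
Proof.
by move=> /LinfP[f1 f2]; rewrite /normsq; under eq_fun do rewrite !expr2;
  apply: essbdD; exact: essbdM.
Qed.

Lemma Linf_L2 f : Linf f -> L2 f.
Proof.
move=> h; split; first by case: h.
have /integrableP[_] := essbd_integrable _ (essbd_normsq f h).
by under eq_integral do rewrite /= ger0_norm ?normsq_ge0 //.
Qed.

(** The Fourier coefficient of index 0; for a Hardy function it is the value at the origin. *)
Definition mean f : R[i] :=
  Complex (avg (fun t => complex.Re (f t))) (avg (fun t => complex.Im (f t))).

Lemma fourierE f (n : int) : fourier f n = mean (fun t => f t * expi (- n%:~R * t)).
Proof. by apply: complex_ext; rewrite /fourier ?ReM ?ImM /= mul0r ?subr0 ?addr0. Qed.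

Lemma meanD f g : Linf f -> Linf g -> mean (fun t => f t + g t) = mean f + mean g.
Proof.
move=> /LinfP[f1 f2] /LinfP[g1 g2]; apply: complex_ext; rewrite ?ReD ?ImD /= -avgD //.
  by under eq_fun do rewrite ReD.
by under eq_fun do rewrite ImD.
Qed.

Lemma meanZ c f : Linf f -> mean (fun t => c * f t) = c * mean f.
Proof.
move=> /LinfP[f1 f2]; apply: complex_ext; rewrite ?ReM ?ImM /=.
  under eq_fun do rewrite ReM -mulNr.
  rewrite avgD ?avgZ ?mulNr //; apply: essbdM => //; exact: essbd_cst.
under eq_fun do rewrite ImM.
rewrite avgD ?avgZ //; apply: essbdM => //; exact: essbd_cst.
Qed.

Lemma meanN f : Linf f -> mean (fun t => - f t) = - mean f.
Proof. by move=> h; under eq_fun do rewrite -mulN1r; rewrite meanZ // mulN1r. Qed.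

Lemma meanB f g : Linf f -> Linf g -> mean (fun t => f t - g t) = mean f - mean g.
Proof. by move=> hf hg; rewrite meanD ?meanN //; exact: LinfN. Qed.

Lemma mean_cst c : mean (fun=> c) = c.
Proof. by apply: complex_ext; rewrite /= avg_cst. Qed.

Lemma mean_conj f : Linf f -> mean (fun t => cconj (f t)) = cconj (mean f).
Proof.
move=> /LinfP[f1 f2]; apply: complex_ext => //=.
by under eq_fun do rewrite -mulN1r; rewrite avgZ // mulN1r.
Qed.

Lemma mean_ae f g : cmeasurable f -> cmeasurable g ->
  ae_T (fun t => f t = g t) -> mean f = mean g.
Proof.
move=> [f1 f2] [g1 g2] h; apply: complex_ext => /=; apply: avg_ae => //;
by apply: ae_T_imp h => t _ ->.
Qed.

Lemma avg_derivative (u F : R -> R) : continuous u ->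
  (forall x : R, is_derive x (1 : R) F (u x)) -> F (pi *+ 2) = F 0 -> avg u = 0.
Proof.
move=> cu dF F2.
have cF : continuous F by move=> x; apply/differentiable_continuous/derivable1_diffP; case: (dF x).
rewrite /avg /rint /Rintegral /Defs.circ (continuous_FTC2 (f := u) (F := F)) //.
- by rewrite F2 subee // fine0 mulr0.
- exact: pi2_gt0.
- exact: continuous_subspaceT.
- split; first by move=> x _; case: (dF x).
    exact: cvg_at_right_filter (cF 0).
  exact: cvg_at_left_filter (cF _).
- by move=> x _; rewrite derive1E; case: (dF x).
Qed.

Lemma expi_natmul2pi (n : int) : expi (n%:~R * (pi *+ 2)) = 1 :> R[i].
Proof.
have h (k : nat) : expi (k%:R * (pi *+ 2)) = 1 :> R[i].
  have -> : k%:R * (pi *+ 2) = 0 + pi *+ 2 *+ k :> R by rewrite add0r mulr_natl.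
  apply: complex_ext => /=.
    by rewrite (periodicn (@cosD2pi R)) cos0.
  by rewrite (periodicn (@sinD2pi R)) sin0.
case: n => k; first exact: h.
by rewrite NegzE mulrNz mulNr expiN h; apply: complex_ext => //=; rewrite oppr0.
Qed.

(** The real and imaginary parts have the primitives sin(nt)/n and -cos(nt)/n, which agree at 0 and
    2 pi. *)
Lemma mean_expi (n : int) : n != 0 -> mean (fun t => expi (n%:~R * t)) = 0.
Proof.
rewrite -(intr_eq0 R); move: (expi_natmul2pi n).
set r : R := n%:~R => E r0; have := E => /(congr1 (@complex.Re R)) /= cE.
have /(congr1 (@complex.Im R)) /= sE := E.
have dr (x : R) : is_derive x (1 : R) (fun y : R => r * y) (r * 1).
  exact: (is_deriveZ r (is_derive_id x (1 : R))).
have cr : continuous (fun y : R => r * y) by move=> x; exact: mulrl_continuous.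
apply: complex_ext => /=.
- apply: (avg_derivative _ (r^-1 \*: (sin \o (fun y => r * y)))) => /=.
  + move=> x; exact: (continuous_comp (cr x) (@continuous_cos R _)).
  + move=> x; apply: is_derive_eq (is_deriveZ _ (is_derive1_comp (is_derive_sin _) (dr x))) _.
    by rewrite mulr1 /GRing.scale /= mulrCA mulVf // mulr1.
  + by rewrite /= sE mulr0 sin0.
- apply: (avg_derivative _ ((- r^-1) \*: (cos \o (fun y => r * y)))) => /=.
  + move=> x; exact: (continuous_comp (cr x) (@continuous_sin R _)).
  + move=> x; apply: is_derive_eq (is_deriveZ _ (is_derive1_comp (is_derive_cos _) (dr x))) _.
    by rewrite mulr1 /GRing.scale /=; field.
  + by rewrite /= cE mulr0 cos0.
Qed.

(** The squared L^2 norm for the normalized measure. *)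
Definition energy f : R := avg (fun t => normsq (f t)).

Lemma energy_ge0 f : 0 <= energy f.
Proof. by apply: avg_ge0 => t; exact: normsq_ge0. Qed.

Lemma mean_mul_conj f : mean (fun t => f t * cconj (f t)) = ((energy f)%:C)%C.
Proof.
under eq_fun do rewrite mul_cconj.
by apply: complex_ext => //=; rewrite avg_cst.
Qed.

Lemma energyD f g : Linf f -> Linf g ->
  energy (fun t => f t + g t) <= 2 * energy f + 2 * energy g.
Proof.
move=> hf hg; have nf := essbd_normsq f hf; have ng := essbd_normsq g hg.
rewrite /energy -!avgZ // -avgD; try by apply: essbdM => //; exact: essbd_cst.
apply: avg_le; [exact/essbd_normsq/LinfD| |by move=> t; exact: normsqD].
by apply: essbdD; apply: essbdM => //; exact: essbd_cst.
Qed.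

Lemma energy_eq0 f : Linf f -> energy f = 0 -> ae_T (fun t => f t = 0).
Proof.
move=> hf /(avg_eq0 _ (essbd_normsq f hf) (fun t => normsq_ge0 _)).
by apply: ae_T_imp => t _ /eqP; rewrite normsq_eq0 => /eqP.
Qed.

(** Pythagoras: the two cross terms are conjugate to each other, so one vanishing mean removes
    both. *)
Lemma energy_add_orth f g : Linf f -> Linf g -> mean (fun t => f t * cconj (g t)) = 0 ->
  energy (fun t => f t + g t) = energy f + energy g.
Proof.
move=> hf hg o.
have cf := Linf_conj _ hf; have cg := Linf_conj _ hg.
apply: (@complexI R); rewrite -mean_mul_conj rmorphD /= -!mean_mul_conj.
have -> : (fun t => (f t + g t) * cconj (f t + g t)) =
  (fun t => (f t * cconj (f t) + g t * cconj (g t)) +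
     (f t * cconj (g t) + cconj (f t * cconj (g t)))).
  by apply/funext => t; rewrite cconjD cconjM cconjK; ring.
have h1 := LinfM _ _ hf cf; have h2 := LinfM _ _ hg cg; have h3 := LinfM _ _ hf cg.
have h4 := Linf_conj _ h3.
rewrite meanD ?[X in _ + X]meanD ?meanD //; try exact: LinfD.
rewrite (mean_conj _ h3) o.
by rewrite [cconj 0](_ : _ = 0) ?addr0 //; apply: complex_ext; rewrite //= oppr0.
Qed.

(** Pythagoras again: a function of mean zero is orthogonal to constants. *)
Lemma energy_sub_mean f : Linf f ->
  energy f = energy (fun t => f t - mean f) + normsq (mean f).
Proof.
move=> hf.
have e : energy (fun=> mean f) = normsq (mean f) by rewrite /energy avg_cst.
rewrite -{}e -energy_add_orth; last 3 first.
- by apply: LinfB => //; exact: Linf_cst.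
- exact: Linf_cst.
- under eq_fun do rewrite mulrC.
  by rewrite meanZ ?meanB ?mean_cst ?subrr ?mulr0 //; try apply: LinfB => //; exact: Linf_cst.
by under [in RHS]eq_fun do rewrite subrK.
Qed.

Lemma normsq_mean_le f : Linf f -> normsq (mean f) <= energy f.
Proof. by move=> hf; rewrite [X in _ <= X]energy_sub_mean // lerDr energy_ge0. Qed.

End Mean.

(** * Density of trigonometric polynomials *)

Section TrigPolynomials.
Context {R : realType}.
Implicit Types (f g p q : R -> R[i]) (c : R[i]) (P Q : int -> Prop).

Lemma realCD (x y : R) : ((x + y)%:C = x%:C + y%:C)%C.
Proof. by apply: complex_ext; rewrite //= addr0. Qed.
Lemma realCB (x y : R) : ((x - y)%:C = x%:C - y%:C)%C.
Proof. by apply: complex_ext; rewrite //= subr0. Qed.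
Lemma realCM (x y : R) : ((x * y)%:C = x%:C * y%:C)%C.
Proof. by apply: complex_ext; rewrite ?ReM ?ImM /= ?mulr0 ?mul0r ?subr0 ?addr0. Qed.
Lemma realC_sum N (F : nat -> R) :
  ((\sum_(k < N) F k)%:C = \sum_(k < N) (F k)%:C)%C.
Proof.
elim: N => [|N IH]; first by rewrite !big_ord0.
by rewrite !big_ord_recr /= realCD IH.
Qed.

(** Trigonometric polynomials with frequencies in [P]. Building them term by term gives induction on
    terms, and [P] separates analytic from antianalytic ones. *)
Inductive tpoly P : (R -> R[i]) -> Prop :=
| tpoly0 : tpoly P (fun=> 0)
| tpolyS f (n : int) c : P n -> tpoly P f -> tpoly P (fun t => f t + c * expi (n%:~R * t)).

Lemma tpoly_expi P (n : int) c : P n -> tpoly P (fun t => c * expi (n%:~R * t)).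
Proof. by move=> Pn; under eq_fun do rewrite -[_ * _]add0r; exact: tpolyS (tpoly0 P). Qed.

Lemma tpoly_cst P c : P 0 -> tpoly P (fun=> c).
Proof.
move=> P0; have := tpoly_expi P 0 c P0.
by under eq_fun do rewrite mul0r expi0 mulr1.
Qed.

Lemma tpolyD P f g : tpoly P f -> tpoly P g -> tpoly P (fun t => f t + g t).
Proof.
move=> hf; elim=> [|h n c Pn hh IH]; first by under eq_fun do rewrite addr0.
by under eq_fun do rewrite addrA; exact: tpolyS.
Qed.

Lemma tpolyZ P c f : tpoly P f -> tpoly P (fun t => c * f t).
Proof.
elim=> [|h n d Pn hh IH]; first by under eq_fun do rewrite mulr0; exact: tpoly0.
by under eq_fun do rewrite mulrDr mulrA; exact: tpolyS.
Qed.

Lemma tpoly_sum P (F : nat -> R -> R[i]) N :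
  (forall k, tpoly P (F k)) -> tpoly P (fun t => \sum_(k < N) F k t).
Proof.
move=> h; elim: N => [|N IH].
  by under eq_fun do rewrite big_ord0; exact: tpoly0.
by under eq_fun do rewrite big_ord_recr /=; exact: tpolyD.
Qed.

Lemma tpoly_shift P (x : R) f : tpoly P f -> tpoly P (fun t => f (t - x)).
Proof.
elim=> [|h n d Pn hh IH]; first exact: tpoly0.
under eq_fun do rewrite mulrBr expiD [expi (_ * _) * _]mulrC mulrA.
exact: tpolyS.
Qed.

Lemma tpoly_Linf P f : tpoly P f -> Linf f.
Proof.
elim=> [|h n d Pn hh IH]; first exact: Linf_cst.
by apply: LinfD => //; apply: LinfM; [exact: Linf_cst|exact: Linf_expi].
Qed.

Lemma tpoly_split P Q f : tpoly (fun=> True) f ->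
  (forall n, P n \/ Q n) ->
  exists p q, [/\ tpoly P p, tpoly Q q & f = (fun t => p t + q t)].
Proof.
move=> hf PQ; elim: hf => [|h n c _ _ [p [q [hp hq ->]]]].
  by exists (fun=> 0), (fun=> 0); split; [exact: tpoly0..|under [RHS]eq_fun do rewrite addr0].
have [Pn|Qn] := PQ n.
  exists (fun t => p t + c * expi (n%:~R * t)), q; split => //; first exact: tpolyS.
  by apply/funext => t; rewrite addrAC.
exists p, (fun t => q t + c * expi (n%:~R * t)); split => //; first exact: tpolyS.
by apply/funext => t; rewrite addrA.
Qed.

Lemma tpoly_sin (n : int) : tpoly (fun=> True) (fun t : R => ((sin (n%:~R * t))%:C)%C).
Proof.
have -> : (fun t : R => ((sin (n%:~R * t))%:C)%C) = (fun t : R =>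
  Complex 0 (- 2^-1) * expi (n%:~R * t) + Complex 0 (2^-1) * expi ((- n)%:~R * t)).
  apply/funext => t; rewrite mulrNz mulNr expiN.
  by apply: complex_ext; rewrite ?ReD ?ImD ?ReM ?ImM /=; field.
by apply: tpolyD; exact: tpoly_expi.
Qed.

Lemma tpoly_sawSum N : tpoly (fun=> True) (fun t : R => ((sawSum N t)%:C)%C).
Proof.
have -> : (fun t : R => (sawSum N t)%:C)%C = (fun t => \sum_(n < N) (sineSum n t)%:C)%C.
  by apply/funext => t; exact: (realC_sum N (fun n => sineSum n t)).
apply: (tpoly_sum _ (fun n t => ((sineSum n t)%:C)%C)) => n.
have -> : (fun t : R => (sineSum n t)%:C)%C =
    (fun t => \sum_(k < n) (2 / k.+1%:R)%:C * (sin (k.+1%:R * t))%:C)%C.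
  apply/funext => t; rewrite [LHS](realC_sum _ (fun k => 2 / k.+1%:R * sin (k.+1%:R * t))).
  by apply: eq_bigr => k _; exact: realCM.
apply: (tpoly_sum _ (fun k t => (2 / k.+1%:R)%:C * (sin (k.+1%:R * t))%:C)%C) => k.
by apply: tpolyZ; exact: (tpoly_sin k.+1).
Qed.

End TrigPolynomials.

Import HBNNSimple.

(** * L^2 approximation of bounded functions by trigonometric polynomials *)

Section Density.
Context {R : realType}.
Implicit Types (f g p q : R -> R[i]) (c : R[i]) (u v : R -> R) (A : set R).
Local Notation mu := (@lebesgue_measure R).
Local Notation circ := (@circ R).
Let circ_m : measurable circ := circ_measurable.
Hint Resolve circ_m : core.

Definition tapprox f := forall e : R, 0 < e ->
  exists p, tpoly (fun=> True) p /\ energy (fun t => f t - p t) < e.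

Lemma tpoly_tapprox p : tpoly (fun=> True) p -> tapprox p.
Proof.
move=> hp e e0; exists p; split => //; rewrite /energy.
by under eq_fun do rewrite subrr normsq0; rewrite avg_cst.
Qed.

Lemma energy_ae f g : Linf f -> Linf g -> ae_T (fun t => f t = g t) -> energy f = energy g.
Proof.
move=> hf hg h; apply: avg_ae; [exact: (essbd_normsq f hf).1|exact: (essbd_normsq g hg).1|].
by apply: ae_T_imp h => t _ ->.
Qed.

Lemma tapprox_closed f : Linf f ->
  (forall e : R, 0 < e -> exists g, [/\ Linf g, tapprox g & energy (fun t => f t - g t) < e]) ->
  tapprox f.
Proof.
(* [energyD] doubles each of the two errors, whence the quarters. *)
move=> hf h e e0; have e4 : 0 < e / 4 by rewrite divr_gt0.
have [g [hg ag eg]] := h _ e4; have [p [hp ep]] := ag _ e4.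
exists p; split => //; have lp := tpoly_Linf _ _ hp.
have -> : (fun t => f t - p t) = (fun t => (f t - g t) + (g t - p t)).
  by apply/funext => t; rewrite addrA subrK.
have := energyD _ _ (LinfB _ _ hf hg) (LinfB _ _ hg lp).
by move/le_lt_trans; apply; lra.
Qed.

Lemma tapprox_ae f g : Linf f -> Linf g -> ae_T (fun t => f t = g t) -> tapprox g -> tapprox f.
Proof.
move=> hf hg h ag; apply: tapprox_closed => // e e0; exists g; split => //.
rewrite (energy_ae _ (fun=> 0)); last 3 first.
- exact: LinfB.
- exact: Linf_cst.
- by apply: ae_T_imp h => t _ ->; rewrite subrr.
by rewrite /energy avg_cst normsq0.
Qed.

Lemma tapproxD f g : Linf f -> Linf g -> tapprox f -> tapprox g -> tapprox (fun t => f t + g t).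
Proof.
move=> hf hg af ag e e0; have e4 : 0 < e / 4 by rewrite divr_gt0.
have [p [hp ep]] := af _ e4; have [q [hq eq]] := ag _ e4.
have lp := tpoly_Linf _ _ hp; have lq := tpoly_Linf _ _ hq.
exists (fun t => p t + q t); split; first exact: tpolyD.
have -> : (fun t => f t + g t - (p t + q t)) = (fun t => (f t - p t) + (g t - q t)).
  by apply/funext => t; ring.
have := energyD _ _ (LinfB _ _ hf lp) (LinfB _ _ hg lq).
by move/le_lt_trans; apply; lra.
Qed.

Lemma tapproxZ c f : Linf f -> tapprox f -> tapprox (fun t => c * f t).
Proof.
move=> hf af e e0.
(* Adding 1 keeps the divisor positive when [c] is 0. *)
have n0 : 0 < normsq c + 1 by rewrite ltr_wpDl // normsq_ge0.
have e1 : 0 < e / (normsq c + 1) by rewrite divr_gt0.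
have [p [hp ep]] := af _ e1; have lp := tpoly_Linf _ _ hp.
exists (fun t => c * p t); split; first exact: tpolyZ.
rewrite /energy; under eq_fun do rewrite -mulrBr normsqM.
rewrite avgZ; last by apply: essbd_normsq; exact: LinfB.
rewrite -/(energy _); set E := energy _ in ep *.
have E0 : 0 <= E by exact: energy_ge0.
move: ep; rewrite ltr_pdivlMr // => ep.
by apply: le_lt_trans ep; rewrite mulrC ler_wpM2l // lerDl.
Qed.

Lemma tapprox_cst c : tapprox (fun=> c).
Proof. by apply: tpoly_tapprox; exact: tpoly_cst. Qed.

Lemma Linf_real u : essbd u -> Linf (fun t => ((u t)%:C)%C).
Proof. by move=> h; apply/LinfP; split => //=; exact: essbd_cst. Qed.

(** A bounded sequence converging almost everywhere converges in L^2: bounded convergence applies to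
    the squares of the differences. *)
Lemma tapprox_cvg u (v : nat -> R -> R) (M : R) : essbd u ->
  (forall n, measurable_fun circ (v n)) ->
  (forall n, tapprox (fun t => ((v n t)%:C)%C)) ->
  (forall n, ae_T (fun t => `|v n t| <= M)) ->
  ae_T (fun t => v n t @[n --> \oo] --> u t) ->
  tapprox (fun t => ((u t)%:C)%C).
Proof.
move=> hu mv av hM vu.
have hv n : essbd (v n) by split=> //; exists M.
apply: tapprox_closed; first exact: Linf_real.
have [mu' [N hN]] := hu.
pose h n t := (u t - v n t) ^+ 2.
have mh n : measurable_fun circ (h n).
  by apply: (measurableT_comp (exprn_measurable 2)); exact: measurable_funB.
have hh n : ae_T (fun t => `|h n t| <= (N + M) ^+ 2).
  apply: ae_T_imp2 hN (hM n) => t _ h1 h2.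
  rewrite /h normrX lerXn2r ?nnegrE //.
    by rewrite addr_ge0 // (le_trans _ h1, le_trans _ h2).
  by apply: (le_trans (ler_normB _ _)); exact: lerD.
have h0 : ae_T (fun t => h n t @[n --> \oo] --> (0 : R)).
  apply: ae_T_imp vu => t _ vt.
  have : (u t - v n t) @[n --> \oo] --> u t - u t by apply: cvgB => //; exact: cvg_cst.
  rewrite subrr => H; have := cvgM H H; rewrite mulr0 => H2.
  under eq_cvg do rewrite /h expr2.
  exact: H2.
have := rint_cvg0 h _ mh hh h0.
move=> /cvgrPdist_lt H e e0.
have [n _ /(_ n (leqnn _))] := H _ (mulr_gt0 e0 (@pi2_gt0 R)).
rewrite sub0r normrN => hn.
exists (fun t => ((v n t)%:C)%C); split; [exact: Linf_real| exact: av|].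
rewrite /energy; under eq_fun do rewrite -realCB normsqR.
rewrite /avg mulrC ltr_pdivrMr ?pi2_gt0 //.
exact: (le_lt_trans (ler_norm _) hn).
Qed.

Lemma circP (t : R) : circ t -> 0 <= t <= pi *+ 2.
Proof. by rewrite /Defs.circ /= in_itv. Qed.

Lemma ae_T_neq (x : R) : ae_T (fun t => t != x).
Proof.
exists [set x]; split => //; first exact: lebesgue_measure_set1.
by move=> t /= /not_implyP[_ /negP]; rewrite negbK => /eqP.
Qed.

Lemma essbd_indic A : measurable A -> essbd (\1_A : R -> R).
Proof.
move=> mA; split; first exact: measurable_indic.
by exists 1; apply: ae_T_all => t; rewrite indicE; case: (_ \in _); rewrite ?normr1 ?normr0.
Qed.

Definition rapprox u := tapprox (fun t => ((u t)%:C)%C).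

(** With s the 2 pi-periodic sawtooth, s(t - x) - s(t) is x for t > x and x - 2 pi for t < x. Adding
    2 pi - x and dividing by 2 pi gives the indicator; [v N] is the same expression in Cesaro
    means. *)
Lemma rapprox_ray_mid (x : R) : 0 <= x < pi *+ 2 -> rapprox (\1_(`]x, +oo[%classic)).
Proof.
move=> /andP[x0 x2].
pose v N t : R := (sawSum N (t - x) / N%:R - sawSum N t / N%:R + (pi *+ 2 - x)) / (pi *+ 2).
have tp N : tpoly (fun=> True) (fun t => ((v N t)%:C)%C).
  have -> : (fun t => ((v N t)%:C)%C) = (fun t =>
    (((N%:R)^-1 / (pi *+ 2))%:C)%C * ((sawSum N (t - x))%:C)%C +
    (((- (N%:R)^-1 / (pi *+ 2))%:C)%C * ((sawSum N t)%:C)%C + (((pi *+ 2 - x) / (pi *+ 2))%:C)%C)).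
    apply/funext => t; rewrite -!realCM -!realCD; congr (_%:C)%C; rewrite /v; ring.
  apply: tpolyD.
    apply: tpolyZ; exact: (tpoly_shift _ x (fun t => ((sawSum N t)%:C)%C) (tpoly_sawSum N)).
  by apply: tpolyD; [apply: tpolyZ; exact: tpoly_sawSum|exact: tpoly_cst].
have sb N t : - (pi *+ 2) <= t <= pi *+ 2 -> `|sawSum N t / N%:R| <= (pi : R).
  move=> h; rewrite normrM normfV (ger0_norm (ler0n _ N)).
  have := sawSum_bound N t h; case: N => [|N] hN.
    (* For [N] = 0 the quotient is 0, since the inverse of 0 is 0. *)
    by rewrite invr0 mulr0 pi_ge0.
  by rewrite ler_pdivrMr ?ltr0n // mulrC.
have p0 := @pi_gt0 R; have pp0 := @pi2_gt0 R.
(* The bound 2: the numerator of [v] is at most pi + pi + 2 pi in absolute value. *)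
apply: (@tapprox_cvg _ v 2).
- by apply: essbd_indic; exact: measurable_itv.
- move=> N; have [/= h _] := tpoly_Linf _ _ (tp N); exact: h.1.
- by move=> N; exact: tpoly_tapprox.
- move=> N; apply: ae_T_imp (ae_T_all (fun=> True) (fun=> I)) => t /circP/andP[t0 t2] _.
  rewrite /v normrM [X in _ * X]ger0_norm ?invr_ge0 ?(ltW pp0) // ler_pdivrMr //.
  have h1 : `|sawSum N t / N%:R| <= (pi : R) by apply: sb; lra.
  have h2 : `|sawSum N (t - x) / N%:R| <= (pi : R) by apply: sb; lra.
  move: h1 h2; rewrite !ler_norml; move: x2; rewrite mulr2n; lra.
(* The points 0, [x] and 2 pi, where an argument leaves the open interval of [sawSum_cvg], form a
   null set. *)
- apply: ae_T_imp2 (ae_T_neq 0)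
    (ae_T_imp2 _ _ _ (fun t _ a b => conj a b) (ae_T_neq x) (ae_T_neq (pi *+ 2))) => t.
  move=> /circP/andP[t0 t2] tn0 [tnx tn2].
  have {}t0 : 0 < t by rewrite lt_neqAle eq_sym tn0.
  have {}t2 : t < pi *+ 2 by rewrite lt_neqAle tn2.
  have c1 : sawSum N t / N%:R @[N --> \oo] --> pi - t by apply: sawSum_cvg; rewrite t0.
  rewrite indicE; case: (ltgtP x t) tnx => // xt _.
  + rewrite mem_set /= ?in_itv /= ?xt //.
    have c2 : sawSum N (t - x) / N%:R @[N --> \oo] --> pi - (t - x) by apply: sawSum_cvg; lra.
    have -> : 1 = ((pi - (t - x)) - (pi - t) + (pi *+ 2 - x)) / (pi *+ 2) :> R.
      by rewrite mulr2n; field; lra.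
    by apply: cvgMl; apply: cvgD; [exact: cvgB|exact: cvg_cst].
  + rewrite memNset /= ?in_itv /= ?andbT; last by apply/negP; rewrite -leNgt ltW.
    rewrite mulr0n.
    have c2 : sawSum N (t - x) / N%:R @[N --> \oo] --> pi - (t - x + pi *+ 2).
      (* Here t - x is negative; a period is added to bring it into ]0, 2 pi[. *)
      under eq_cvg do rewrite -sawSumD2pi.
      by apply: sawSum_cvg; lra.
    have -> : 0 = ((pi - (t - x + pi *+ 2)) - (pi - t) + (pi *+ 2 - x)) / (pi *+ 2) :> R.
      by rewrite mulr2n; field; lra.
    by apply: cvgMl; apply: cvgD; [exact: cvgB|exact: cvg_cst].
Qed.

Lemma rapprox_eq_on_circ u v : essbd u -> essbd v -> (forall t, circ t -> u t = v t) ->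
  rapprox v -> rapprox u.
Proof.
move=> hu hv h; apply: tapprox_ae; [exact: Linf_real|exact: Linf_real|].
by apply: ae_T_imp (ae_T_all (fun=> True) (fun=> I)) => t ct _; rewrite h.
Qed.

(** For [x] outside [0, 2 pi[ the indicator is constant on the circle. *)
Lemma rapprox_ray (x : R) : rapprox (\1_(`]x, +oo[%classic)).
Proof.
have hx : essbd (\1_(`]x, +oo[%classic) : R -> R) by apply: essbd_indic; exact: measurable_itv.
have [x0|x0] := ltP x 0.
  apply: (rapprox_eq_on_circ _ (fun=> 1)) => //; [exact: essbd_cst| |exact: tapprox_cst].
  move=> t /circP/andP[t0 _].
  by rewrite indicE mem_set //= in_itv /= andbT (lt_le_trans x0).
have [x2|x2] := ltP x (pi *+ 2); first by apply: rapprox_ray_mid; rewrite x0.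
apply: (rapprox_eq_on_circ _ (fun=> 0)) => //; [exact: essbd_cst| |exact: tapprox_cst].
move=> t /circP/andP[_ t2].
by rewrite indicE memNset //= in_itv /= andbT; apply/negP; rewrite -leNgt (le_trans t2).
Qed.

Lemma rapproxD u v : essbd u -> essbd v -> rapprox u -> rapprox v -> rapprox (fun t => u t + v t).
Proof.
move=> hu hv au av; rewrite /rapprox; under eq_fun do rewrite realCD.
by apply: tapproxD => //; exact: Linf_real.
Qed.

Lemma rapproxZ (r : R) u : essbd u -> rapprox u -> rapprox (fun t => r * u t).
Proof.
move=> hu au; rewrite /rapprox; under eq_fun do rewrite realCM.
by apply: tapproxZ => //; exact: Linf_real.
Qed.

Lemma essbdZ (r : R) u : essbd u -> essbd (fun t => r * u t).
Proof. by move=> hu; apply: essbdM => //; exact: essbd_cst. Qed.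

Lemma rapprox_sum (I : Type) (s : seq I) (F : I -> R -> R) :
  (forall i, essbd (F i) /\ rapprox (F i)) ->
  essbd (fun t => \sum_(i <- s) F i t) /\ rapprox (fun t => \sum_(i <- s) F i t).
Proof.
move=> h; elim: s => [|i s [IH1 IH2]].
  by under eq_fun do rewrite big_nil; split; [exact: essbd_cst|exact: tapprox_cst].
under eq_fun do rewrite big_cons; have [h1 h2] := h i.
by split; [exact: essbdD|exact: rapproxD].
Qed.

(** Dynkin: open rays are stable under intersection and generate the Borel sets. Complements follow
    by linearity, disjoint unions by bounded convergence of the partial sums. *)
Lemma rapprox_indic A : measurable A -> rapprox (\1_A).
Proof.
have mE : measurable = <<s @RGenOInfty.G R >> :> set (set R) by exact: RGenOInfty.measurableE.
move=> mA; have : <<s @RGenOInfty.G R >> A by rewrite -mE.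
apply: (dynkin_induction (P := fun A : set R => rapprox (\1_A))) => //.
- move=> B C [x ->] [y ->]; exists (Num.max x y).
  by apply/seteqP; split => t /=; rewrite !in_itv /= !andbT gt_max => /andP.
- by rewrite indicT; exact: (tapprox_cst ((1 : R)%:C)%C).
- by move=> B [x ->]; exact: rapprox_ray.
- move=> S mS aS.
  have -> : \1_(~` S) = (fun t => 1 + (-1) * \1_S t) :> (R -> R).
    apply/funext => t; rewrite !indicE in_setC.
    by case: (_ \in _); rewrite ?mulr1 ?mulr0 ?subrr ?addr0.
  have hS := essbd_indic S mS.
  apply: rapproxD; [exact: essbd_cst|exact: essbdZ|exact: tapprox_cst|exact: rapproxZ].
- move=> F mF tF aF.
  (* Disjointness leaves at most one nonzero summand at each point. *)
  have Fk k n t : F k t -> \sum_(i < n) \1_(F i) t = (k < n)%:R :> R.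
    move=> Fkt; case: ltnP => kn.
      rewrite (bigD1 (Ordinal kn)) //= indicE mem_set // big1 ?addr0 // => i ik.
      rewrite indicE memNset // => Fit; move/eqP: ik; apply; apply: val_inj => /=.
      by apply: (tF i k) => //; exists t.
    rewrite big1 // => i _; rewrite indicE memNset // => Fit.
    have ik : i = k :> nat by apply: (tF i k) => //; exists t.
    by have := ltn_ord i; rewrite ik ltnNge kn.
  have mU : measurable (\bigcup_k F k) by apply: bigcup_measurable => k _; exact: mF.
  have H n : essbd (fun t => \sum_(i < n) \1_(F i) t : R) /\
      rapprox (fun t => \sum_(i < n) \1_(F i) t).
    by apply: (rapprox_sum _ _ (fun i : 'I_n => \1_(F i) : R -> R)) => i;
      split; [exact: essbd_indic|exact: aF].
  apply: (@tapprox_cvg (\1_(\bigcup_k F k)) (fun n t => \sum_(i < n) \1_(F i) t) 1).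
  + exact: essbd_indic.
  + by move=> n; case: (H n) => -[].
  + by move=> n; case: (H n).
  + move=> n; apply: ae_T_all => t; have [[k _ Fkt]|nF] := pselect ((\bigcup_k F k) t).
      by rewrite (Fk k) //; case: (k < n)%N; rewrite ?normr1 ?normr0.
    by rewrite big1 ?normr0 // => i _; rewrite indicE memNset // => Fit; apply: nF; exists i.
  + apply: ae_T_all => t; rewrite indicE.
    have [[k _ Fkt]|nF] := pselect ((\bigcup_k F k) t).
      rewrite mem_set; last by exists k.
      apply: cvg_near_cst; exists k.+1 => // n /= kn.
      by rewrite (Fk k) // kn.
    rewrite memNset //; apply: cvg_near_cst; apply: nearW => n.
    by rewrite big1 // => i _; rewrite indicE memNset // => Fit; apply: nF; exists i.
Qed.

(** Increasing simple functions converge to [u] and stay below it, so they share its bound; each is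
    a finite combination of indicators. *)
Lemma rapprox_nonneg u : essbd u -> (forall t, 0 <= u t) -> rapprox u.
Proof.
move=> hu u0; have [mu' [M hM]] := hu.
have mEu : measurable_fun circ (EFin \o u) by apply/measurable_EFinP.
have [g [gnd gcvg]] := approximation circ_m mEu (fun t _ => u0 t).
have gu t : circ t -> g n t @[n --> \oo] --> u t.
  by move=> ct; have /fine_cvg := gcvg t ct.
have mg n A : measurable A -> measurable (g n @^-1` A).
  by move=> mA; rewrite -[X in measurable X]setTI; exact: measurable_funP.
have ag n : rapprox (g n).
  have -> : (g n : R -> R) = (fun t =>
      \sum_(y <- finmap.enum_fset (fset_set (range (g n)))) y * \1_(g n @^-1` [set y]) t).
    by apply/funext => t; rewrite fimfunE fsbig_finite.
  have [] // := rapprox_sum _ (finmap.enum_fset (fset_set (range (g n))))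
    (fun y t => y * \1_(g n @^-1` [set y]) t).
  move=> y; have my : measurable (g n @^-1` [set y]) by exact: mg.
  split; first by apply: essbdZ; exact: essbd_indic.
  by apply: rapproxZ; [exact: essbd_indic|exact: rapprox_indic].
apply: (@tapprox_cvg u (fun n => g n) M) => //.
- by move=> n; apply: measurable_funTS; exact: measurable_funP.
- move=> n; apply: ae_T_imp hM => t ct; rewrite !ger0_norm //; apply: le_trans.
  have nd : nondecreasing_seq (fun n => g n t).
    by move=> i j ij; have /lefP := gnd _ _ ij; apply.
  have c : cvgn (fun n => g n t) by apply/cvg_ex; exists (u t); exact: gu.
  have := nondecreasing_cvgn_le nd c n.
  by rewrite (cvg_lim _ (gu t ct)).
- by apply: ae_T_imp (ae_T_all (fun=> True) (fun=> I)) => t ct _; exact: gu.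
Qed.

Lemma rapprox_essbd u : essbd u -> rapprox u.
Proof.
move=> hu; have [mu' [M hM]] := hu.
have ha : essbd (fun t => `|u t|).
  split; first exact: measurableT_comp.
  by exists M; apply: ae_T_imp hM => t _; rewrite normr_id.
have hn : essbd (fun t => `|u t| + (-1) * u t) by apply: essbdD => //; exact: essbdZ.
(* A difference of two nonnegative bounded functions, |u| and |u| - u. *)
have -> : u = (fun t => `|u t| + (-1) * (`|u t| + (-1) * u t)).
  by apply/funext => t; ring.
apply: rapproxD => //; first exact: essbdZ.
  by apply: rapprox_nonneg.
apply: rapproxZ => //; apply: rapprox_nonneg => // t.
by rewrite mulN1r subr_ge0 ler_norm.
Qed.

Lemma Linf_tapprox f : Linf f -> tapprox f.
Proof.
move=> /LinfP[h1 h2].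
have -> : f = (fun t => ((complex.Re (f t))%:C)%C + Complex 0 1 * ((complex.Im (f t))%:C)%C).
  by apply/funext => t; apply: complex_ext; rewrite ?ReD ?ImD ?ReM ?ImM /=; ring.
apply: tapproxD; [exact: Linf_real| |exact: rapprox_essbd|].
  by apply: LinfM; [exact: Linf_cst|exact: Linf_real].
by apply: tapproxZ; [exact: Linf_real|exact: rapprox_essbd].
Qed.

End Density.

(** * Bounded Hardy functions *)

Section BoundedHardy.
Context {R : realType}.
Implicit Types (f g p q : R -> R[i]) (c : R[i]) (u v : R -> R).
Local Notation circ := (@circ R).

Lemma avg_le_ae u v : essbd u -> essbd v -> ae_T (fun t => u t <= v t) -> avg u <= avg v.
Proof.
move=> hu hv uv.
have hn : essbd (fun t => v t + (-1) * u t) by apply: essbdD => //; exact: essbdZ.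
have mn : measurable_fun circ (fun t => `|v t + (-1) * u t|).
  by apply: measurableT_comp => //; case: hn.
rewrite -subr_ge0 -mulN1r -avgZ // -avgD //; last exact: essbdZ.
(* The integrand is nonnegative only almost everywhere; its absolute value is so everywhere, as
   [avg_ge0] asks. *)
rewrite (avg_ae _ (fun t => `|v t + (-1) * u t|)) //; last first.
- by apply: ae_T_imp uv => t _ h; rewrite ger0_norm // mulN1r subr_ge0.
- by case: hn.
- by apply: avg_ge0.
Qed.

Lemma energy_mul_le f g (M : R) : Linf f -> Linf g -> ae_T (fun t => normsq (g t) <= M) ->
  energy (fun t => f t * g t) <= M * energy f.
Proof.
move=> hf hg hM; rewrite /energy -avgZ; last exact: essbd_normsq.
apply: avg_le_ae; [exact/essbd_normsq/LinfM|apply: essbdZ; exact: essbd_normsq|].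
by apply: ae_T_imp hM => t _ h; rewrite normsqM mulrC ler_wpM2r // normsq_ge0.
Qed.

Lemma fourier0 f : fourier f 0 = mean f.
Proof. by rewrite fourierE; under eq_fun do rewrite oppr0 mul0r expi0 mulr1. Qed.

Lemma fourier_shift f (n : int) :
  fourier (fun t => f t * expi (- t)) n = fourier f (n + 1).
Proof.
rewrite !fourierE; congr mean; apply/funext => t.
by rewrite -mulrA -expiD rmorphD /=; congr (_ * expi _); ring.
Qed.

Lemma fourierD f g n : Linf f -> Linf g ->
  fourier (fun t => f t + g t) n = fourier f n + fourier g n.
Proof.
move=> hf hg; rewrite !fourierE; under eq_fun do rewrite mulrDl.
by rewrite meanD //; apply: LinfM => //; exact: Linf_expi.
Qed.

Lemma fourierZ c f n : Linf f -> fourier (fun t => c * f t) n = c * fourier f n.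
Proof.
move=> hf; rewrite !fourierE; under eq_fun do rewrite -mulrA.
by rewrite meanZ //; apply: LinfM => //; exact: Linf_expi.
Qed.

Lemma fourier_ae f g n : Linf f -> Linf g -> ae_T (fun t => f t = g t) ->
  fourier f n = fourier g n.
Proof.
move=> hf hg h; rewrite !fourierE; apply: mean_ae.
- exact: (LinfM _ _ hf (Linf_expi _)).1.
- exact: (LinfM _ _ hg (Linf_expi _)).1.
- by apply: ae_T_imp h => t _ ->.
Qed.

(** The space H^infinity of the disc, through boundary values. Pairs in [Hbar] have bounded entries,
    so integrability of products is automatic. *)
Definition hardy f := Linf f /\ forall n : int, n < 0 -> fourier f n = 0.

Lemma hardy_H2 f : hardy f -> H2 f.
Proof. by move=> [hf h]; split => //; exact: Linf_L2. Qed.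

Lemma hardyD f g : hardy f -> hardy g -> hardy (fun t => f t + g t).
Proof.
move=> [hf f0] [hg g0]; split; first exact: LinfD.
by move=> n n0; rewrite fourierD // f0 // g0 // addr0.
Qed.

Lemma hardyZ c f : hardy f -> hardy (fun t => c * f t).
Proof.
move=> [hf f0]; split; first by apply: LinfM => //; exact: Linf_cst.
by move=> n n0; rewrite fourierZ // f0 // mulr0.
Qed.

Lemma hardy_ae f g : Linf f -> hardy g -> ae_T (fun t => f t = g t) -> hardy f.
Proof.
move=> hf [hg g0] h; split => // n n0.
by rewrite (fourier_ae _ g) // g0.
Qed.

(** Division by z: coefficients move down by one index, and the only one that could become forbidden
    is the vanishing value at the origin. *)
Lemma hardy_shift f : hardy f -> mean f = 0 -> hardy (fun t => f t * expi (- t)).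
Proof.
move=> [hf f0] m0; split.
  apply: LinfM => //; have := Linf_expi (-1 : R).
  by under eq_fun do rewrite mulN1r.
move=> n n0; rewrite fourier_shift.
have [->|nn] := eqVneq n (-1); first by rewrite addNr fourier0.
by apply: f0; lia.
Qed.

Lemma tpoly_conj (P : int -> Prop) p : tpoly P p ->
  tpoly (fun n => P (- n)) (fun t => cconj (p t)).
Proof.
elim=> [|h n c Pn hh IH].
  by rewrite (_ : (fun t => _) = fun=> 0); [exact: tpoly0|apply/funext => t];
    apply: complex_ext; rewrite //= oppr0.
rewrite (_ : (fun t => _) = fun t => cconj (h t) + cconj c * expi ((- n)%:~R * t)); last first.
  by apply/funext => t; rewrite cconjD cconjM -expiN -mulNr -mulrNz.
by apply: tpolyS => //; rewrite opprK.
Qed.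

(** The mean of [f] times e^{int} is the Fourier coefficient of [f] at -n, hence the sign in the
    hypothesis. *)
Lemma mean_mul_tpoly (P : int -> Prop) f p : Linf f -> tpoly P p ->
  (forall n, P n -> fourier f (- n) = 0) -> mean (fun t => f t * p t) = 0.
Proof.
move=> hf hp f0; elim: hp => [|h n c Pn hh IH].
  by under eq_fun do rewrite mulr0; rewrite mean_cst.
have hl := tpoly_Linf _ _ hh.
under eq_fun do rewrite mulrDr [f _ * (c * _)]mulrCA.
rewrite meanD ?IH ?add0r; last 2 first.
- exact: LinfM.
- by apply: LinfM; [exact: Linf_cst|apply: LinfM => //; exact: Linf_expi].
rewrite meanZ; last by apply: LinfM => //; exact: Linf_expi.
have := f0 _ Pn; rewrite fourierE; under eq_fun do rewrite mulrNz opprK.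
by move=> ->; rewrite mulr0.
Qed.

Lemma fourier_expi (n m : int) c : n != m -> fourier (fun t : R => c * expi (n%:~R * t)) m = 0.
Proof.
move=> nm; rewrite fourierZ; last exact: Linf_expi.
rewrite fourierE; under eq_fun do rewrite -expiD -mulrDl -mulrNz -intrD.
by rewrite mean_expi ?mulr0 // subr_eq0.
Qed.

Lemma fourier_tpoly (P : int -> Prop) p m : tpoly P p -> ~ P m -> fourier p m = 0.
Proof.
move=> hp Pm; elim: hp => [|h n c Pn hh IH].
  by rewrite fourierE; under eq_fun do rewrite mul0r; rewrite mean_cst.
rewrite fourierD; last 2 first.
- exact: tpoly_Linf hh.
- by apply: LinfM; [exact: Linf_cst|exact: Linf_expi].
rewrite IH fourier_expi ?addr0 //.
by apply/eqP => nm; apply: Pm; rewrite -nm.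
Qed.

(* Evaluation at the origin is multiplicative.  Approximating f in L^2 by a
   trigonometric polynomial, its antianalytic part may be dropped, since it is
   orthogonal to f; what remains annihilates g - mean g. *)
Lemma mean_mul f g : hardy f -> hardy g -> mean (fun t => f t * g t) = mean f * mean g.
Proof.
move=> [hf f0] [hg g0].
pose h t := g t - mean g.
have hc : Linf (fun _ : R => mean g) by exact: Linf_cst.
have hh : Linf h by exact: LinfB.
(* Subtracting the mean also removes the coefficient of index 0, so [h] has only positive
   frequencies. *)
have h0 n : 0 <= n -> fourier h (- n) = 0.
  move=> n0; have [->|nn] := eqVneq n 0.
    by rewrite oppr0 fourier0 meanB // mean_cst subrr.
  have -> : h = (fun t => g t + (- mean g) * expi ((0 : int)%:~R * t)).
    by apply/funext => t; rewrite mulr0z mul0r expi0 mulr1.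
  rewrite fourierD //; last by apply: LinfM; [exact: Linf_cst|exact: Linf_expi].
  rewrite g0 ?oppr_lt0 ?lt_def ?nn // add0r.
  by apply: (fourier_expi 0); rewrite eq_sym oppr_eq0.
have [_ [M hM]] := hh.
have key : mean (fun t => f t * h t) = 0.
  apply/eqP; rewrite -normsq_eq0; apply/eqP/le_anti; rewrite normsq_ge0 andbT.
  (* A bound for |h|^2 that is positive, so that the tolerance e / K makes sense. *)
  pose K := Num.max M 0 + 1.
  have K0 : 0 < K by rewrite ltr_wpDl // le_max lexx orbT.
  have hK : ae_T (fun t => normsq (h t) <= K).
    apply: ae_T_imp hM => t _ hm; apply: (le_trans hm).
    by rewrite (@le_trans _ _ (Num.max M 0)) ?lerDl // le_max lexx.
  apply/ler_addgt0Pl => e e0; rewrite addr0.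
  have [p [hp ep]] := Linf_tapprox f hf _ (divr_gt0 e0 K0).
  have PQ (n : int) : 0 <= n \/ n < 0 by case: (leP 0 n) => _; [left|right].
  have [p1 [q [hp1 hq pE]]] := tpoly_split (fun n => 0 <= n) (fun n => n < 0) p hp PQ.
  have l1 := tpoly_Linf _ _ hp1; have lq := tpoly_Linf _ _ hq.
  pose r t := f t - p1 t.
  have hr : Linf r by exact: LinfB.
  have o : mean (fun t => r t * cconj (- q t)) = 0.
    apply: (mean_mul_tpoly (fun n => 0 < n)) => //.
      have H : tpoly (fun n => - n < 0) (fun t => cconj (- q t)).
        rewrite (_ : (fun t => _) = fun t => (-1) * cconj (q t)).
          by apply: tpolyZ; exact: tpoly_conj _ _ hq.
        by apply/funext => t; rewrite cconjN mulN1r.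
      elim: H => [|z n c Pn _]; first exact: tpoly0.
      by apply: tpolyS; rewrite -oppr_lt0.
    move=> n n0; rewrite /r; under [X in fourier X]eq_fun do rewrite -mulN1r.
    rewrite fourierD ?fourierZ //; last by apply: LinfM => //; exact: Linf_cst.
    rewrite f0 ?oppr_lt0 // (fourier_tpoly _ _ _ hp1) ?mulr0 ?addr0 //.
    by apply/negP; rewrite -ltNge oppr_lt0.
  (* By Pythagoras, dropping the antianalytic part [q] does not increase the error. *)
  have er : energy r < e / K.
    apply: le_lt_trans ep; rewrite pE.
    have -> : (fun t => f t - (p1 t + q t)) = (fun t => r t + (- q t)).
      by apply/funext => t; rewrite /r; ring.
    rewrite energy_add_orth //; last exact: LinfN.
    by rewrite lerDl energy_ge0.
  have -> : mean (fun t => f t * h t) = mean (fun t => r t * h t).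
    have z : mean (fun t => h t * p1 t) = 0 by apply: (mean_mul_tpoly _ _ _ hh hp1).
    have -> : (fun t => f t * h t) = (fun t => r t * h t + h t * p1 t).
      by apply/funext => t; rewrite /r; ring.
    by rewrite meanD ?z ?addr0 //; exact: LinfM.
  apply: (le_trans (normsq_mean_le _ (LinfM _ _ hr hh))).
  apply: (le_trans (energy_mul_le _ _ _ hr hh hK)).
  by rewrite ltW // mulrC -ltr_pdivlMr.
have : mean (fun t => f t * h t) = mean (fun t => f t * g t) - mean f * mean g.
  rewrite /h; under eq_fun do rewrite mulrBr [f _ * mean g]mulrC.
  by rewrite meanB ?meanZ //; [rewrite [mean g * _]mulrC|exact: LinfM|exact: LinfM].
by rewrite key => /esym/eqP; rewrite subr_eq0 => /eqP.
Qed.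

End BoundedHardy.

(** * The layer-stripping step *)

Section SchurStep.
Context {R : realType}.
Implicit Types (a b c d f g : R -> R[i]) (y : R[i]).
Local Notation circ := (@circ R).

Lemma Linf_normsq_le f (M : R) : cmeasurable f -> ae_T (fun t => normsq (f t) <= M) -> Linf f.
Proof. by move=> mf h; split=> //; exists M. Qed.

Lemma H2_hardy f : H2 f -> Linf f -> hardy f.
Proof. by move=> [_ h] hf. Qed.

Lemma mean_fstar f : at_infty f = cconj (mean (fun t => cconj (f t))).
Proof. by rewrite /at_infty fourier0. Qed.

Lemma at_inftyE f : Linf f -> at_infty f = mean f.
Proof. by move=> hf; rewrite mean_fstar mean_conj // cconjK. Qed.

(** The working form of [Hbar]: the relation |a|^2 + |b|^2 = 1 makes both entries bounded, so the
    H^2 conditions become [hardy] ones and a(oo) becomes a mean. *)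
Lemma HbarP a b : Hbar a b <->
  [/\ hardy (fun t => cconj (a t)), hardy b,
      ae_T (fun t => normsq (a t) + normsq (b t) = 1) & 0 < mean a].
Proof.
have nE t : a t * cconj (a t) + b t * cconj (b t) = ((normsq (a t) + normsq (b t))%:C)%C.
  by rewrite !mul_cconj realCD.
split.
  move=> [[ma [mb [h [Ha a0]]]] Hb].
  have {}h : ae_T (fun t => normsq (a t) + normsq (b t) = 1).
    by apply: ae_T_imp h => t _; rewrite nE => /complexI.
  have la : Linf a.
    apply: (Linf_normsq_le _ 1) => //; apply: ae_T_imp h => t _ <-.
    by rewrite lerDl normsq_ge0.
  have lb : Linf b.
    apply: (Linf_normsq_le _ 1) => //; apply: ae_T_imp h => t _ <-.
    by rewrite lerDr normsq_ge0.
  split => //; last by rewrite -at_inftyE.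
    apply: (H2_hardy _ Ha); exact: Linf_conj.
  exact: H2_hardy.
move=> [Ha Hb h a0].
have la : Linf a by have := Linf_conj _ Ha.1; under eq_fun do rewrite cconjK.
split; last exact: hardy_H2.
split; first by case: la.
split; first by case: Hb => -[].
split; first by apply: ae_T_imp h => t _; rewrite nE => ->.
by split; [exact: hardy_H2|rewrite at_inftyE].
Qed.

Lemma Linf_of_conj a : Linf (fun t => cconj (a t)) -> Linf a.
Proof. by move=> h; have := Linf_conj _ h; under eq_fun do rewrite cconjK. Qed.

Lemma Hbar_Linf a b : Hbar a b -> Linf a /\ Linf b.
Proof. by move=> /HbarP[[/Linf_of_conj la _] [lb _] _ _]. Qed.

(** In the order of [R[i]], being positive includes being real. *)
Lemma mean_real a b : Hbar a b ->
  exists2 r : R, 0 < r & mean a = (r%:C)%C.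
Proof.
move=> /HbarP[_ _ _]; rewrite ltcE /= => /andP[/eqP i0 r0].
by exists (complex.Re (mean a)) => //; apply: complex_ext.
Qed.

Lemma scal_gt0 y : 0 < scal y.
Proof. by rewrite /scal invr_gt0 sqrtr_gt0 ltr_wpDr // normsq_ge0. Qed.

Lemma scal_sqr y : scal y ^+ 2 * (1 + normsq y) = 1.
Proof.
have h : 0 < 1 + normsq y by rewrite ltr_wpDr // normsq_ge0.
by rewrite /scal exprVn sqr_sqrtr ?(ltW h) // mulVf // lt0r_neq0.
Qed.

Lemma scal_le1 y : scal y <= 1.
Proof.
rewrite -(@ler_pXn2r _ 2) ?nnegrE ?(ltW (scal_gt0 y)) // expr1n -(scal_sqr y).
by rewrite ler_peMr ?sqr_ge0 // lerDl normsq_ge0.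
Qed.

(** The normalized factor acts as a unitary matrix on the vector formed by u and the conjugate of
    v. *)
Lemma normsq_step y (u v : R[i]) :
  normsq (((scal y)%:C)%C * (u + y * cconj v)) +
  normsq (((scal y)%:C)%C * (v - y * cconj u)) = normsq u + normsq v.
Proof.
rewrite !normsqM normsqR -mulrDr -[RHS]mul1r -(scal_sqr y) -mulrA; congr (_ * _).
case: u v y => [u1 u2] [v1 v2] [y1 y2].
by rewrite /normsq !ReD !ImD /=; ring.
Qed.

Definition step_fst y a b t : R[i] := ((scal y)%:C)%C * (a t + y * cconj (b t)).
(** The second component before division by z, that is z d(z). *)
Definition step_snd y a b t : R[i] := ((scal y)%:C)%C * (b t - y * cconj (a t)).

Lemma step_fst_Linf y a b : Linf a -> Linf b -> Linf (step_fst y a b).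
Proof.
move=> la lb; apply: LinfM; [exact: Linf_cst|apply: LinfD => //].
by apply: LinfM; [exact: Linf_cst|exact: Linf_conj].
Qed.

Lemma step_snd_Linf y a b : Linf a -> Linf b -> Linf (step_snd y a b).
Proof.
move=> la lb; apply: LinfM; [exact: Linf_cst|apply: LinfB => //].
by apply: LinfM; [exact: Linf_cst|exact: Linf_conj].
Qed.

Lemma mean_step_fst y a b : Linf a -> Linf b ->
  mean (step_fst y a b) = ((scal y)%:C)%C * (mean a + y * cconj (mean b)).
Proof.
move=> la lb; have lb' := Linf_conj _ lb.
have lyb : Linf (fun t => y * cconj (b t)) by apply: LinfM => //; exact: Linf_cst.
by rewrite /step_fst meanZ ?meanD ?meanZ ?mean_conj //; exact: LinfD.
Qed.

Lemma mean_step_snd y a b : Linf a -> Linf b ->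
  mean (step_snd y a b) = ((scal y)%:C)%C * (mean b - y * cconj (mean a)).
Proof.
move=> la lb; have la' := Linf_conj _ la.
have lya : Linf (fun t => y * cconj (a t)) by apply: LinfM => //; exact: Linf_cst.
by rewrite /step_snd meanZ ?meanB ?meanZ ?mean_conj //; exact: LinfB.
Qed.

Lemma hardy_step_snd y a b : hardy (fun t => cconj (a t)) -> hardy b -> hardy (step_snd y a b).
Proof.
move=> ha hb; apply: hardyZ; apply: hardyD => //.
by under eq_fun do rewrite -mulNr; exact: hardyZ.
Qed.

Lemma hardy_step_fst y a b : hardy (fun t => cconj (a t)) -> hardy b ->
  hardy (fun t => cconj (step_fst y a b t)).
Proof.
move=> ha hb; rewrite /step_fst.
under eq_fun do rewrite cconjM cconjD cconjM cconjK.
by apply: hardyZ; apply: hardyD => //; exact: hardyZ.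
Qed.

Lemma scalC_neq0 y : ((scal y)%:C)%C != 0.
Proof.
apply/negP => /eqP /(congr1 (@complex.Re R)) /= h.
by have := scal_gt0 y; rewrite h ltxx.
Qed.

(** This [y] makes the mean of [step_snd] vanish, so that division by z stays in the Hardy space;
    the new mean is then [scal y] (1 + |y|^2) [mean a], which is positive. *)
Lemma step_exists a b : Hbar a b -> let y := mean b / mean a in
  Hbar (step_fst y a b) (fun t => step_snd y a b t * expi (- t)) /\
  step_rel y a b (step_fst y a b) (fun t => step_snd y a b t * expi (- t)).
Proof.
move=> H y; have [la lb] := Hbar_Linf _ _ H; have [r r0 ar] := mean_real _ _ H.
have [ha hb n1 a0] := (HbarP _ _).1 H.
have bE : mean b = y * mean a by rewrite divfK // lt0r_neq0.
split; last first.
  by apply: ae_T_all => t; split => //; rewrite -mulrA [expi _ * _]mulrC mul_expiN mulr1.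
apply/HbarP; split.
- exact: hardy_step_fst.
- apply: hardy_shift; first exact: hardy_step_snd.
  by rewrite mean_step_snd // bE ar cconjR subrr mulr0.
- apply: ae_T_imp n1 => t _ <-; rewrite -(normsq_step y (a t) (b t)).
  by rewrite [X in _ + X]normsqM normsq_expi mulr1.
- rewrite mean_step_fst // bE ar cconjM cconjR mulrA mul_cconj -realCM -realCD -realCM ltcR.
  by rewrite mulr_gt0 ?scal_gt0 // ltr_wpDr // mulr_ge0 ?normsq_ge0 // ltW.
Qed.

(** The mean of z d(z) is the coefficient of [d] at -1, which is zero because [d] is a Hardy
    function. *)
Lemma step_mean a b c d y : Hbar a b -> Hbar c d -> step_rel y a b c d ->
  mean c = mean (step_fst y a b) /\ mean (step_snd y a b) = 0.
Proof.
move=> /Hbar_Linf[la lb] Hcd h; have [lc ld] := Hbar_Linf _ _ Hcd.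
have ls := step_snd_Linf y _ _ la lb; have lf := step_fst_Linf y _ _ la lb.
split; first by apply: mean_ae; [case: lc|case: lf|apply: ae_T_imp h => t _ []].
have [_ [_ hd] _ _] := (HbarP _ _).1 Hcd.
rewrite -(hd (-1)) // fourierE; apply: mean_ae; first by case: ls.
  exact: (LinfM _ _ ld (Linf_expi _)).1.
apply: ae_T_imp h => t _ [_ e].
by rewrite rmorphN rmorph1 opprK mul1r e.
Qed.

(** Uniqueness: the vanishing mean of [step_snd] reads [mean b] = y [mean a], as [mean a] is
    real. *)
Lemma step_coefficient a b c d y : Hbar a b -> Hbar c d -> step_rel y a b c d ->
  y = mean b / mean a.
Proof.
move=> H Hcd h; have [la lb] := Hbar_Linf _ _ H; have [r r0 ar] := mean_real _ _ H.
have [_ /eqP] := step_mean _ _ _ _ _ H Hcd h.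
rewrite mean_step_snd // ar cconjR mulf_eq0 (negbTE (scalC_neq0 y)) /= subr_eq0 => /eqP ->.
rewrite mulfK //; apply/negP => /eqP /(congr1 (@complex.Re R)) /= h0.
by move: r0; rewrite h0 ltxx.
Qed.

(** Substituting [mean b] = y [mean a] gives [mean c] = [scal y] (1 + |y|^2) [mean a], and [scal y]
    squared cancels 1 + |y|^2. *)
Lemma step_at_infty a b c d y : Hbar a b -> Hbar c d -> step_rel y a b c d ->
  mean a = ((scal y)%:C)%C * mean c.
Proof.
move=> H Hcd h; have [la lb] := Hbar_Linf _ _ H; have [r r0 ar] := mean_real _ _ H.
have [-> /eqP] := step_mean _ _ _ _ _ H Hcd h.
rewrite mean_step_snd // mean_step_fst // mulf_eq0 (negbTE (scalC_neq0 y)) /= subr_eq0 => /eqP ->.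
rewrite ar cconjM !cconjR [y * (_ * _)]mulrA mul_cconj -realCM -realCD -!realCM; congr (_%:C)%C.
by rewrite -[LHS]mul1r -(scal_sqr y); ring.
Qed.

Lemma normsq_mean_le1 a b : Linf a -> Linf b ->
  ae_T (fun t => normsq (a t) + normsq (b t) = 1) -> normsq (mean a) <= 1.
Proof.
move=> la lb h; apply: (le_trans (normsq_mean_le _ la)).
rewrite -(avg_cst 1); apply: avg_le_ae; [exact: essbd_normsq|exact: essbd_cst|].
by apply: ae_T_imp h => t _ <-; rewrite lerDl normsq_ge0.
Qed.

(** * Propagation of a common inner factor *)

Section CommonFactor.
Variable g : R -> R[i].
Hypothesis ig : inner g.

Lemma inner_normsq : ae_T (fun t => normsq (g t) = 1).
Proof. by case: ig => _; apply: ae_T_imp => t _; rewrite mul_cconj => /complexI. Qed.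

Lemma inner_hardy : hardy g.
Proof. by case: ig => -[H [M hM]] _; apply: H2_hardy => //; split; [case: H => -[]|exists M]. Qed.

(** The energy of [g] is 1, so |g(0)| = 1 would leave no energy for g - g(0). *)
Lemma normsq_mean_inner_lt1 : ~ const_ae g -> normsq (mean g) < 1.
Proof.
have [lg _] := inner_hardy.
move=> nc; rewrite lt_neqAle; apply/andP; split.
  apply/negP => /eqP e; apply: nc; exists (mean g).
  have : energy (fun t => g t - mean g) = 0.
    have := energy_sub_mean _ lg; rewrite e.
    have -> : energy g = 1.
      rewrite -(avg_cst 1); apply: avg_ae; [exact: (essbd_normsq _ lg).1|exact: measurable_cst|].
      exact: inner_normsq.
    by move=> h; apply: (addIr 1); rewrite add0r -h.
  move/energy_eq0 => h.
  have : ae_T (fun t => g t - mean g = 0) by apply: h; apply: LinfB => //; exact: Linf_cst.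
  by apply: ae_T_imp => t _ /eqP; rewrite subr_eq0 => /eqP.
apply: (normsq_mean_le1 _ (fun=> 0) lg); first exact: Linf_cst.
by apply: ae_T_imp inner_normsq => t _ ->; rewrite normsq0 addr0.
Qed.

(* The quotients by [g] are written as products with [cconj (g t)], since [|g| = 1]. *)
Definition divides a b :=
  hardy (fun t => cconj (a t) * cconj (g t)) /\ hardy (fun t => b t * cconj (g t)).

Lemma inner_mul_conj f : ae_T (fun t => f t = g t * (f t * cconj (g t))).
Proof.
apply: ae_T_imp inner_normsq => t _ h.
by rewrite mulrCA mul_cconj h mulr1.
Qed.

Lemma mean_inner_mul f : Linf f -> hardy (fun t => f t * cconj (g t)) ->
  mean f = mean g * mean (fun t => f t * cconj (g t)).
Proof.
move=> lf hf; have hg := inner_hardy; rewrite -mean_mul //.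
apply: mean_ae; [by case: lf|exact: (LinfM _ _ hg.1 hf.1).1|exact: inner_mul_conj].
Qed.

(** The value of a^* at 0 is g(0) times that of a^*/g. The latter is at most 1 in modulus, since
    a^*/g and b/g still have squared moduli summing to 1. *)
Lemma divides_mean_le a b : Hbar a b -> divides a b -> normsq (mean a) <= normsq (mean g).
Proof.
move=> H [da db]; have [ha hb n1 _] := (HbarP _ _).1 H.
have [la lb] := Hbar_Linf _ _ H.
rewrite -normsq_cconj -mean_conj // (mean_inner_mul (fun t => cconj (a t)) ha.1 da) normsqM.
apply: ler_piMr; first exact: normsq_ge0.
apply: (normsq_mean_le1 _ _ da.1 db.1).
apply: ae_T_imp2 n1 inner_normsq => t _ h hg.
by rewrite !normsqM !normsq_cconj hg !mulr1.
Qed.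

(** The quotients of c^* and z d by [g] are linear combinations of those of a^* and b. To divide the
    second by z it must vanish at 0: its value there times g(0) is zero, while g(0) is not. *)
Lemma divides_step a b c d y : Hbar a b -> Hbar c d -> step_rel y a b c d ->
  divides a b -> divides c d.
Proof.
move=> H Hcd h [da db]; have [la lb] := Hbar_Linf _ _ H; have [lc ld] := Hbar_Linf _ _ Hcd.
have [ha hb _ _] := (HbarP _ _).1 H.
have [lg _] := inner_hardy; have lg' := Linf_conj _ lg.
split.
  apply: (hardy_ae _ (fun t => ((scal y)%:C)%C *
    (cconj (a t) * cconj (g t) + cconj y * (b t * cconj (g t))))).
  - by apply: LinfM => //; exact: Linf_conj.
  - by apply: hardyZ; apply: hardyD => //; exact: hardyZ.
  - by apply: ae_T_imp h => t _ [-> _]; rewrite cconjM cconjD cconjM cconjK cconjR; ring.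
pose f t := ((scal y)%:C)%C * (b t * cconj (g t) + (- y) * (cconj (a t) * cconj (g t))).
have hf : hardy f by apply: hardyZ; apply: hardyD => //; exact: hardyZ.
have fE : f = fun t => step_snd y a b t * cconj (g t).
  by apply/funext => t; rewrite /f /step_snd; ring.
apply: (hardy_ae _ (fun t => f t * expi (- t))).
- exact: LinfM.
- apply: hardy_shift => //.
  have [_ s0] := step_mean _ _ _ _ _ H Hcd h.
  (* Otherwise a^* would vanish at 0, where its value is a(oo) > 0. *)
  have g0 : mean g != 0.
    have [r r0 ar] := mean_real _ _ H.
    apply/negP => /eqP g0; have := mean_inner_mul _ ha.1 da.
    rewrite g0 mul0r mean_conj // ar cconjR => /(congr1 (@complex.Re R)) /= e.
    by move: r0; rewrite e ltxx.
  have := mean_inner_mul (step_snd y a b) (step_snd_Linf _ _ _ la lb).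
  rewrite s0 -fE => /(_ hf) /esym/eqP; rewrite mulf_eq0 (negbTE g0) /=.
  by move/eqP.
- apply: ae_T_imp h => t _ [_ e].
  rewrite fE [step_snd _ _ _ _](_ : _ = d t * expi t) //.
  by rewrite -!mulrA; congr (_ * _); rewrite mulrCA mul_expiN mulr1.
Qed.

End CommonFactor.
End SchurStep.

(** * The iterated step: summability and the product bound *)

Section SchurSequence.
Context {R : realType}.
Variables (a b : R -> R[i]) (A B : nat -> R -> R[i]) (F : nat -> R[i]).
Hypothesis abF : schur_seq a b A B F.

Let HAB n : Hbar (A n) (B n). Proof. by case: abF => _ [_ []]. Qed.
Let step n : step_rel (F n) (A n) (B n) (A n.+1) (B n.+1).
Proof. by case: abF => _ [_ []]. Qed.

(** The value a_n(oo), moved to [R] so that the estimates are between reals. *)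
Let re n : R := complex.Re (mean (A n)).

Let re_gt0 n : 0 < re n.
Proof. by rewrite /re; have [r r0 ->] := mean_real _ _ (HAB n). Qed.

Let mean_re n : mean (A n) = ((re n)%:C)%C.
Proof. by rewrite /re; have [r r0 ->] := mean_real _ _ (HAB n). Qed.

Lemma schur_at_infty n : re 0%N = partial_prod F n * re n.
Proof.
elim: n => [|n ->]; first by rewrite /partial_prod big_ord0 mul1r.
rewrite /partial_prod big_ord_recr /= -mulrA; congr (_ * _).
have := step_at_infty _ _ _ _ _ (HAB n) (HAB n.+1) (step n).
by rewrite !mean_re -realCM => /complexI.
Qed.

Lemma partial_prod_gt0 n : 0 < partial_prod F n.
Proof. by apply: prodr_gt0 => k _; exact: scal_gt0. Qed.

Lemma schur_mean_le (M : R) n : 0 <= M -> normsq (mean (A n)) <= M ^+ 2 -> re n <= M.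
Proof.
move=> M0; rewrite mean_re normsqR ler_pXn2r // ?nnegrE //.
exact: ltW.
Qed.

Lemma schur_mean_le1 n : re n <= 1.
Proof.
have [_ _ n1 _] := (HbarP _ _).1 (HAB n); have [la lb] := Hbar_Linf _ _ (HAB n).
by apply: schur_mean_le => //; rewrite expr1n; exact: normsq_mean_le1 n1.
Qed.

Lemma partial_prod_lbound n : re 0%N <= partial_prod F n.
Proof. by rewrite (schur_at_infty n) ler_piMr ?schur_mean_le1 // ltW // partial_prod_gt0. Qed.

(** The partial products decrease and stay above a(oo). *)
Lemma partial_prod_cvg : cvgn (partial_prod F).
Proof.
apply: nonincreasing_is_cvgn; last first.
  by exists (re 0%N) => _ [n _ <-]; exact: partial_prod_lbound.
apply/nonincreasing_seqP => n; rewrite /partial_prod big_ord_recr /=.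
by rewrite ler_piMr ?scal_le1 // ltW // partial_prod_gt0.
Qed.

(** Expanding the product, 1 + sum |F_k|^2 is at most the product of the 1 + |F_k|^2, the inverse
    square of [partial_prod], which is at most a(oo)^{-2}. *)
Lemma series_normsq_cvg : cvgn (series (fun n => normsq (F n))).
Proof.
apply: nondecreasing_is_cvgn.
  apply/nondecreasing_seqP => n.
  by rewrite /series /= big_nat_recr //= lerDl normsq_ge0.
exists (re 0%N ^+ 2)^-1 => _ [n _ <-]; rewrite /series /= big_mkord.
have h : 1 + \sum_(k < n) normsq (F k) <= (partial_prod F n ^+ 2)^-1.
  elim: n => [|n IH]; first by rewrite /partial_prod !big_ord0 addr0 expr1n invr1.
  rewrite /partial_prod !big_ord_recr /= exprMn invfM -/(partial_prod F n).
  have -> : (scal (F n) ^+ 2)^-1 = 1 + normsq (F n).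
    rewrite -[LHS]mulr1 -[in LHS](scal_sqr (F n)) mulKf //.
    by rewrite sqrf_eq0 lt0r_neq0 // scal_gt0.
  have f0 := normsq_ge0 (F n).
  have s0 : 0 <= \sum_(k < n) normsq (F k) by apply: sumr_ge0 => k _; exact: normsq_ge0.
  apply: (@le_trans _ _ ((1 + \sum_(k < n) normsq (F k)) * (1 + normsq (F n)))).
    by have := mulr_ge0 s0 f0; lra.
  by apply: ler_wpM2r => //; rewrite addr_ge0.
apply: (@le_trans _ _ ((partial_prod F n ^+ 2)^-1)); first by apply: le_trans h; rewrite lerDr.
rewrite lef_pV2 ?posrE ?exprn_gt0 ?partial_prod_gt0 //.
by rewrite ler_pXn2r ?nnegrE ?partial_prod_lbound // ltW // partial_prod_gt0.
Qed.

(** Used with M = 1 for the inequality and with M = |g(0)| for its strict form. *)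
Lemma schur_at_infty_le (M : R) : (forall n, re n <= M) -> 0 <= M ->
  re 0%N <= M * limn (partial_prod F).
Proof.
move=> h M0.
have c : (M * partial_prod F n) @[n --> \oo] --> M * limn (partial_prod F).
  by apply: cvgMl_tmp; exact: partial_prod_cvg.
rewrite -(cvg_lim _ c) //; apply: limr_ge; first by apply/cvg_ex; eexists; exact: c.
apply: nearW => n; rewrite (schur_at_infty n) mulrC.
by apply: ler_wpM2r => //; rewrite ltW // partial_prod_gt0.
Qed.

(** Strictness depends on this: a factor below 1 decreases only a positive limit strictly. *)
Lemma schur_lim_gt0 : 0 < limn (partial_prod F).
Proof.
apply: (lt_le_trans (re_gt0 0%N)).
by have := schur_at_infty_le 1 schur_mean_le1 ler01; rewrite mul1r.
Qed.

Lemma schur_at_infty_lt : ~ Hset a b -> re 0%N < limn (partial_prod F).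
Proof.
case: abF => A0 [B0 _] nH.
have [g [ig dg nc]] : exists g, [/\ inner g, divides g (A 0%N) (B 0%N) & ~ const_ae g].
  apply/not_existsP => h; apply: nH; split; first by rewrite -A0 -B0.
  move=> g ig h1 h2; apply: contrapT => nc; apply: (h g); split => //.
  have [lg _] := inner_hardy _ ig; have lg' := Linf_conj _ lg.
  have [la lb] := Hbar_Linf _ _ (HAB 0%N); have la' := Linf_conj _ la.
  have gV : ae_T (fun t => cconj (g t) = (g t)^-1).
    apply: ae_T_imp (inner_normsq _ ig) => t _ hg1.
    have : g t * cconj (g t) = 1 by rewrite mul_cconj hg1.
    move=> e; have g0 : g t != 0.
      by apply/eqP => z; move: e; rewrite z mul0r => /eqP; rewrite eq_sym oner_eq0.
    by apply: (mulfI g0); rewrite e mulfV.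
  (* Dividing by [g] and multiplying by its conjugate agree only almost everywhere; the product
     supplies the essential bound of the quotient. *)
  have tr f : Linf f -> H2 (fun t => f t / g t) -> hardy (fun t => f t * cconj (g t)).
    move=> lf [[m _] hh]; have l1 := LinfM _ _ lf lg'.
    have e : ae_T (fun t => f t * cconj (g t) = f t / g t) by apply: ae_T_imp gV => t _ ->.
    apply: (hardy_ae _ (fun t => f t / g t)) => //; split => //; split => //.
    have [_ [M hM]] := l1; exists M.
    by apply: ae_T_imp2 hM e => t _ + <-.
  by rewrite -A0 -B0 in h1 h2; split; apply: tr.
have dv n : divides g (A n) (B n).
  by elim: n => // n; exact: (divides_step _ ig _ _ _ _ _ (HAB n) (HAB n.+1) (step n)).
(* This is |g(0)|, a bound below 1 for all a_n(oo) at once. *)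
pose rho := Num.sqrt (normsq (mean g)).
have rho1 : rho < 1.
  by rewrite /rho -sqrtr1 ltr_sqrt // normsq_mean_inner_lt1.
have hr n : re n <= rho.
  apply: schur_mean_le; first exact: sqrtr_ge0.
  by rewrite sqr_sqrtr ?normsq_ge0 //; exact: divides_mean_le (HAB n) (dv n).
apply: (le_lt_trans (schur_at_infty_le rho hr (sqrtr_ge0 _))).
by rewrite gtr_pMl // schur_lim_gt0.
Qed.

Lemma schur_at_inftyE : at_infty a = ((re 0%N)%:C)%C.
Proof.
case: (abF) => A0 _; rewrite -A0 at_inftyE ?mean_re //.
by have [] := Hbar_Linf _ _ (HAB 0%N).
Qed.

Lemma schur_seq_properties :
  cvgn (series (fun n => normsq (F n))) /\
  at_infty a <= ((limn (partial_prod F))%:C)%C /\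
  (~ Hset a b -> at_infty a < ((limn (partial_prod F))%:C)%C).
Proof.
rewrite schur_at_inftyE lecR ltcR; split; first exact: series_normsq_cvg.
split; last exact: schur_at_infty_lt.
by have := schur_at_infty_le 1 schur_mean_le1 ler01; rewrite mul1r.
Qed.

End SchurSequence.

(** The explicit coefficient of [step_exists] allows plain iteration, without choosing a pair at
    each stage. *)
Lemma schur_seq_exists {R : realType} (a b : R -> R[i]) : Hbar a b ->
  exists A B F, schur_seq a b A B F.
Proof.
move=> H.
pose y (p : (R -> R[i]) * (R -> R[i])) := mean p.2 / mean p.1.
pose next p := (step_fst (y p) p.1 p.2, fun t => step_snd (y p) p.1 p.2 t * expi (- t)).
pose s n := iter n next (a, b).
have hs n : Hbar (s n).1 (s n).2.
  by elim: n => // n IH; have [] := step_exists _ _ IH.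
exists (fun n => (s n).1), (fun n => (s n).2), (fun n => y (s n)); do 2!split => //.
by split => // n; have [] := step_exists _ _ (hs n).
Qed.

Theorem theorem6p3 (R : realType) (a b : R -> R[i]) :
  Hbar a b ->
  (exists! y : R[i], exists c d : R -> R[i], Hbar c d /\ step_rel y a b c d) /\
  (exists (A B : nat -> R -> R[i]) (F : nat -> R[i]), schur_seq a b A B F) /\
  (forall (A B : nat -> R -> R[i]) (F : nat -> R[i]), schur_seq a b A B F ->
     cvgn (series (fun n => normsq (F n))) /\
     at_infty a <= ((limn (partial_prod F))%:C)%C /\
     (~ Hset a b -> at_infty a < ((limn (partial_prod F))%:C)%C)).
Proof.
move=> H; split; [|split; [exact: schur_seq_exists|exact: schur_seq_properties]].
exists (mean b / mean a); split; first by do 2!eexists; exact: step_exists.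
by move=> y [c [d [Hcd h]]]; rewrite -(step_coefficient _ _ _ _ _ H Hcd h).
Qed.
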